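(* Let $T$ be a Calderón–Zygmund operator on $\mathbb{R}^n$ in the sense $T\in HCZ$. Then: (i) if $T: A_{1}\rightarrow WL^{1}$ (i.e. $\sup_{a\in A_1}\|Ta\|_{WL^1}<\infty$), then $T: A_{1}\rightarrow L^{1}$ (i.e. $\sup_{a\in A_1}\|Ta\|_{L^1}<\infty$); (ii) if $T: A^{0}_{1}\rightarrow WL^{1}$ (i.e. $\sup_{a\in A^0_1}\|Ta\|_{WL^1}<\infty$), then $T: A^{0}_{1}\rightarrow L^{1}$ (i.e. $\sup_{a\in A^0_1}\|Ta\|_{L^1}<\infty$).
   Context: Notation. $B(u,t)$ is the ball in $\mathbb{R}^n$ with center $u$ and radius $t$; $|F|$ is the Lebesgue measure of $F$; $\chi_F$ is the characteristic function of $F$. The class $HCZ$. Let $T$ be a linear operator continuous from $\mathcal{S}(\mathbb{R}^n)$ to $\mathcal{S}'(\mathbb{R}^n)$, with kernel distribution $K(x,y)$, which is a locally integrable function off the diagonal $x=y$; $T^*$ denotes the adjoint (transposed) operator, with kernel $K(y,x)$. One writes $T\in HCZ$ if: (i) size condition: $\sup_{x,\,r>0}\int_{r\le|x-y|\le 2r}\{|K(x,y)|+|K(y,x)|\}\,dy<\infty$; (ii) Hörmander condition: $\sup_{x,x'}\int_{|x-y|\ge 2|x-x'|}\{|K(x,y)-K(x',y)|+|K(y,x)-K(y,x')|\}\,dy<\infty$; (iii) $T1\in \mathrm{BMO}$ and $T^*1\in\mathrm{BMO}$ (in the usual sense of the $T1$ theorem); (iv) weak boundedness: there is a constant $c$ such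 that for all $u\in\mathbb{R}^n$, $t>0$ and $f,g\in C^1_0(B(u,t))$, $|\langle Tf,g\rangle|\le c\,t^n(\|f\|_\infty+t\|\nabla f\|_\infty)(\|g\|_\infty+t\|\nabla g\|_\infty)$. Convention on the action of $T$. $T$ and $T^*$ are understood to act linearly also on bounded compactly supported functions $f$, with $Tf$, $T^*f$ measurable functions, consistently with the original definition on test functions, with $Tf(x)=\int K(x,y)f(y)\,dy$ for a.e. $x\notin\operatorname{supp} f$ (similarly for $T^*$), and with $\langle Tf,g\rangle=\langle f,T^*g\rangle$ whenever these pairings converge absolutely. Atoms. For a cube $E\subset\mathbb{R}^n$ let $N_E$ be the biggest integer such that $2^{N_E}|E|\le 1$. $a\in A_1(E)$ means $\operatorname{supp} a\subset E$, $\|a\|_\infty\le 2^{N_E}$ and $\int a(x)\,dx=0$. $a\in A^0_1(E)$ (characteristic atom) means that there are two sub-cubes $G$ and $H$ of $E$ which do not intersect each other and a (measurable) subset $F$ of $H$ with $|F|=|G|$ such that $a(x)=\frac{1}{|E|}(\chi_F(x)-\chi_G(x))$. $A_1$ and $A^0_1$ are the unions of $A_1(E)$ and $A^0_1(E)$, respectively, over all cubes $E$. Weak $L^1$. $WL^1=WL^1(\mathbb{R}^n)$ is the set of measurable $f$ with $\|f\|_{WL^1}=\sup_{\lambda>0}\lambda|\{x:|f(x)|>\lambda\}|<\infty$. *)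

(* Defs.v *)
From HB Require Import structures.
From mathcomp Require Import all_boot all_order all_algebra.
From mathcomp Require Import all_classical all_reals all_analysis.
From mathcomp Require Import complex.

Set Implicit Arguments.
Unset Strict Implicit.
Unset Printing Implicit Defensive.

Import Order.TTheory GRing.Theory Num.Theory.
Import numFieldNormedType.Exports.

Local Open Scope classical_set_scope.
Local Open Scope ring_scope.

(** * Lebesgue measure on [R^n] *)

(* [R^n] is ['rV[R]_n] with the sigma-algebra generated by the coordinates,
   i.e. its Borel sets.  Every Lebesgue measurable function agrees almost
   everywhere with a Borel one, and functions are only used up to null sets. *)
Definition rV_display : measure_display.
Proof. exact: default_measure_display. Qed.

Section measurable_rV.
Context {R : realType} (n : nat).

Definition rV_coord (i : 'I_n) (x : 'rV[R]_n) : R := x ord0 i.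

Let rV_set0 : g_sigma_preimage rV_coord set0.
Proof. exact: sigma_algebra0. Qed.

Let rV_setC A : g_sigma_preimage rV_coord A -> g_sigma_preimage rV_coord (~` A).
Proof. exact: sigma_algebraC. Qed.

Let rV_bigcup (F : (set 'rV[R]_n)^nat) :
  (forall i, g_sigma_preimage rV_coord (F i)) ->
  g_sigma_preimage rV_coord (\bigcup_i (F i)).
Proof. exact: sigma_algebra_bigcup. Qed.

HB.instance Definition _ := @isMeasurable.Build rV_display
  'rV[R]_n (g_sigma_preimage rV_coord) rV_set0 rV_setC rV_bigcup.

End measurable_rV.

Lemma sigma_finite_product d1 d2 (T1 : measurableType d1)
    (T2 : measurableType d2) (R : realType)
    (m1 : {sigma_finite_measure set T1 -> \bar R})
    (m2 : {sigma_finite_measure set T2 -> \bar R}) :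
  sigma_finite setT (m1 \x m2)%E.
Proof.
have /sigma_finiteP[F [TF ndF Foo]] := sigma_finiteT m1.
have /sigma_finiteP[G [TG ndG Goo]] := sigma_finiteT m2.
exists (fun n => F n `*` G n).
  rewrite -setXTT TF TG predeqE => -[x y]; split.
    move=> [/= [n _ Fnx] [k _ Gky]]; exists (maxn n k) => //; split.
    - by move: x Fnx; exact/subsetPset/ndF/leq_maxl.
    - by move: y Gky; exact/subsetPset/ndG/leq_maxr.
  by move=> [n _ []/= ? ?]; split; exists n.
move=> k; have [? ?] := Foo k; have [? ?] := Goo k.
split; first exact: measurableX.
by rewrite product_measure1E// lte_mul_pinfty// ge0_fin_numE.
Qed.

Section lebesgue_step.
Context {R : realType}.

Lemma measurable_rV_coord n (i : 'I_n) :
  measurable_fun [set: 'rV[R]_n] (rV_coord i).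
Proof.
move=> _ Y mY; rewrite setTI; apply: sub_sigma_algebra => /=.
rewrite -bigcup_seq/=; exists i => /=; first by rewrite mem_index_enum.
by exists Y => //; rewrite setTI.
Qed.

Lemma measurable_fun_rVP d (T : measurableType d) n (f : T -> 'rV[R]_n) :
  (forall i, measurable_fun [set: T] (rV_coord i \o f)) ->
  measurable_fun [set: T] f.
Proof.
move=> mf _ A mA; rewrite setTI.
suff : <<s \big[setU/set0]_(i < n)
    preimage_set_system setT (rV_coord i) measurable >> `<=`
    [set B | measurable (f @^-1` B)] by move/(_ A mA).
apply: smallest_sub.
- split.
  + by rewrite /= preimage_set0.
  + by move=> B /= mB; rewrite setTD preimage_setC; exact: measurableC.
  + by move=> F mF /=; rewrite preimage_bigcup; exact: bigcupT_measurable.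
- case: n f mf A mA => [|n] f mf A mA; first by rewrite big_ord0.
  rewrite -bigcup_mkord_ord; apply: bigcup_sub => i Ii.
  by move=> B [C mC <-]; rewrite setTI /= -[X in measurable X]setTI; exact: mf.
Qed.

(* [lebesgue_measure] lives on the alias [measurableTypeR R] of [R]. *)
Definition rV_cons n (p : measurableTypeR R * 'rV[R]_n) : 'rV[R]_n.+1 :=
  \row_j (if unlift ord0 j is Some k then p.2 ord0 k else p.1).

Definition rV_uncons n (x : 'rV[R]_n.+1) : measurableTypeR R * 'rV[R]_n :=
  (x ord0 ord0, \row_k x ord0 (lift ord0 k)).

Lemma rV_consK n : cancel (@rV_cons n) (@rV_uncons n).
Proof.
move=> [a y]; rewrite /rV_uncons mxE unlift_none; congr pair.
by apply/rowP => k; rewrite !mxE liftK.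
Qed.

Lemma measurable_rV_cons n : measurable_fun setT (@rV_cons n).
Proof.
apply: measurable_fun_rVP => i.
rewrite (_ : _ \o _ = fun p : measurableTypeR R * 'rV[R]_n =>
  if unlift ord0 i is Some k then rV_coord k p.2 else p.1); last first.
  by apply/funext => p /=; rewrite /rV_coord mxE.
case: unliftP => [k _|_]; last exact: measurable_fst.
exact: (measurableT_comp (@measurable_rV_coord n k) measurable_snd).
Qed.

Lemma measurable_rV_uncons n : measurable_fun setT (@rV_uncons n).
Proof.
apply/measurable_fun_pairP; split; first exact: measurable_rV_coord.
apply: measurable_fun_rVP => i.
rewrite (_ : _ \o _ = rV_coord (lift ord0 i)).
  exact: measurable_rV_coord.
by apply/funext => x; rewrite /= /rV_coord mxE.
Qed.

Section step.
Variables (n : nat) (m : {sigma_finite_measure set 'rV[R]_n -> \bar R}).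

Definition lebesgue_cons : set 'rV[R]_n.+1 -> \bar R :=
  pushforward (@lebesgue_measure R \x m)%E (@rV_cons n).

Let lebesgue_cons0 : lebesgue_cons set0 = 0%E.
Proof. by rewrite /lebesgue_cons /pushforward preimage_set0 measure0. Qed.

Let lebesgue_cons_ge0 A : (0 <= lebesgue_cons A)%E.
Proof. by rewrite /lebesgue_cons /pushforward measure_ge0. Qed.

Let lebesgue_cons_sigma_additive : semi_sigma_additive lebesgue_cons.
Proof.
have mc (B : set 'rV[R]_n.+1) : measurable B ->
    measurable (@rV_cons n @^-1` B).
  by move=> mB; rewrite -[X in measurable X]setTI; exact: measurable_rV_cons.
move=> F mF tF mUF; rewrite /lebesgue_cons /pushforward preimage_bigcup.
apply: measure_semi_sigma_additive.
- by move=> k; exact: mc.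
- apply/trivIsetP => /= i j _ _ ij; rewrite -preimage_setI.
  by move/trivIsetP : tF => /(_ _ _ _ _ ij) ->//; rewrite preimage_set0.
- by rewrite -preimage_bigcup; exact: mc.
Qed.

HB.instance Definition _ := isMeasure.Build _ _ _ lebesgue_cons
  lebesgue_cons0 lebesgue_cons_ge0 lebesgue_cons_sigma_additive.

Let lebesgue_cons_sigma_finite : sigma_finite setT lebesgue_cons.
Proof.
have [F FT Foo] := sigma_finite_product (@lebesgue_measure R) m.
exists (fun k => @rV_uncons n @^-1` F k).
  by rewrite -preimage_bigcup -FT preimage_setT.
move=> k; have [mF Foo_k] := Foo k; split.
  by rewrite -[X in measurable X]setTI; exact: measurable_rV_uncons.
rewrite /lebesgue_cons /pushforward -comp_preimage.
by rewrite (_ : _ \o _ = id) //; apply/funext => p /=; rewrite rV_consK.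
Qed.

HB.instance Definition _ := Measure_isSigmaFinite.Build _ _ _ lebesgue_cons
  lebesgue_cons_sigma_finite.

End step.

(* [R^0] is a point, and [R^(n+1)] carries the product measure of [R] and
   [R^n]. *)
Fixpoint lebesgue_rV n : {sigma_finite_measure set 'rV[R]_n -> \bar R} :=
  if n is k.+1 then [the {sigma_finite_measure set _ -> \bar R} of
                       lebesgue_cons (lebesgue_rV k)]
  else [the {sigma_finite_measure set _ -> \bar R} of dirac (0 : 'rV[R]_0)].

End lebesgue_step.

Lemma lebesgue_rV_box (R : realType) n (a b : 'rV[R]_n) :
  (forall i, a ord0 i <= b ord0 i) ->
  lebesgue_rV n [set x | forall i, a ord0 i <= x ord0 i <= b ord0 i] =
  (\prod_i (b ord0 i - a ord0 i))%:E.
Proof.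
elim: n a b => [|n IH] a b ab.
  rewrite big_ord0 /= diracE mem_set//.
  by case.
rewrite /= /lebesgue_cons /pushforward.
pose a' := (rV_uncons a).2; pose b' := (rV_uncons b).2.
set X := (X in product_measure1 _ _ X).
have mbox m (c d : 'rV[R]_m) :
    measurable [set x : 'rV[R]_m | forall i, c ord0 i <= x ord0 i <= d ord0 i].
  rewrite (_ : mkset _ = \bigcap_(i in [set: 'I_m])
      (rV_coord i @^-1` `[c ord0 i, d ord0 i]%classic)); last first.
    apply/seteqP; split=> x /= h i.
      by move=> _; rewrite /rV_coord /= in_itv /= h.
    by have := h i I; rewrite /rV_coord /= in_itv.
  apply: fin_bigcap_measurable; first exact: finite_finset.
  move=> i _; rewrite -[X in measurable X]setTI.
  exact: measurable_rV_coord.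
have -> : X = `[a ord0 ord0, b ord0 ord0]%classic `*`
    [set y : 'rV[R]_n | forall i, a' ord0 i <= y ord0 i <= b' ord0 i].
  apply/seteqP; split=> -[t y]; rewrite /X /=.
    move=> h; split.
      by have := h ord0; rewrite mxE unlift_none in_itv.
    by move=> i; have := h (lift ord0 i); rewrite !mxE liftK.
  move=> [ht hy] i; rewrite mxE; case: unliftP => [k ->|->] /=.
    by have := hy k; rewrite !mxE.
  by move: ht; rewrite in_itv.
rewrite product_measure1E; [|exact: measurable_itv|exact: mbox].
rewrite IH => [|i]; last by rewrite !mxE.
rewrite big_ord_recl EFinM; congr (_ * _)%E.
  transitivity (@lebesgue_measure R `[a ord0 ord0, b ord0 ord0]%classic) => [//|].
  rewrite lebesgue_measure_itv /= lte_fin.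
  case: ltP => [_|ba]; first by rewrite -EFinB.
  have -> : b ord0 ord0 = a ord0 ord0 by apply/eqP; rewrite eq_le ba ab.
  by rewrite subrr.
by congr (_%:E); apply: eq_bigr => i _; rewrite !mxE.
Qed.

(** * Complex-valued functions *)

Section complex_functions.
Context {R : realType}.

Definition cabs (z : R[i]) : R := ComplexField.Normc.normc z.

Section integration.
Context d (T : measurableType d).
Variable mu : {measure set T -> \bar R}.
Implicit Types (D : set T) (f : T -> R[i]).

Definition cmeasurable D f :=
  measurable_fun D (@complex.Re R \o f) /\ measurable_fun D (@complex.Im R \o f).

Definition cintegrable D f :=
  mu.-integrable D (EFin \o @complex.Re R \o f) /\
  mu.-integrable D (EFin \o @complex.Im R \o f).

Definition cintegral D f : R[i] :=
  Complex (\int[mu]_(x in D) complex.Re (f x))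
          (\int[mu]_(x in D) complex.Im (f x)).

End integration.

Section Rn.
Context {n : nat}.
Implicit Types (f g : 'rV[R]_n -> R[i]) (x : 'rV[R]_n).

Local Notation mu := (lebesgue_rV n).

(* The norm of the library on ['rV[R]_n] is the sup norm. *)
Definition enorm x : R := Num.sqrt (\sum_i x ord0 i ^+ 2).

Definition csupp f : set 'rV[R]_n := closure [set x | f x != 0].

Definition Lp_norm (p : \bar R) f : \bar R :=
  Lnorm mu p (fun x => (cabs (f x))%:E).

Definition WL1_norm f : \bar R :=
  ereal_sup [set (lam%:E * mu [set x | (cabs (f x) > lam)%R])%E |
             lam in [set lam : R | 0 < lam]].

Definition loc_integrable f :=
  cmeasurable setT f /\ forall A, compact A -> cintegrable mu A f.

Definition pder (i : 'I_n) f : 'rV[R]_n -> R[i] := fun x =>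
  Complex ('D_(delta_mx ord0 i) (@complex.Re R \o f) x)
          ('D_(delta_mx ord0 i) (@complex.Im R \o f) x).

Definition pders (s : seq 'I_n) f : 'rV[R]_n -> R[i] := foldr pder f s.

Definition cdifferentiable f :=
  forall x, differentiable (@complex.Re R \o f) x /\
            differentiable (@complex.Im R \o f) x.

Definition ccontinuous f :=
  continuous (@complex.Re R \o f) /\ continuous (@complex.Im R \o f).

Definition C1 f := cdifferentiable f /\ forall i, ccontinuous (pder i f).

Definition smooth f := forall s, cdifferentiable (pders s f).

Definition grad_norm f x : R := Num.sqrt (\sum_i cabs (pder i f x) ^+ 2).

(** ** Test functions, Schwartz functions and tempered distributions *)

Definition test_function f := smooth f /\ compact (csupp f).

(* These norms increase with [m] and generate the topology of [S(R^n)]. *)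
Definition schwartz_norm (m : nat) f : \bar R :=
  ereal_sup [set ((1 + enorm p.1) ^+ m * cabs (pders p.2 f p.1))%:E |
             p in [set p : 'rV[R]_n * seq 'I_n | (size p.2 <= m)%N]].

Definition schwartz f :=
  smooth f /\ forall m, (schwartz_norm m f < +oo)%E.

Definition schwartz_continuous (u : ('rV[R]_n -> R[i]) -> R[i]) :=
  forall f (e : R), schwartz f -> 0 < e ->
  exists m (delta : R), 0 < delta /\
    forall g, schwartz g -> (schwartz_norm m (fun x => g x - f x)%R < delta%:E)%E ->
    cabs (u g - u f) < e.

Definition tempered (u : ('rV[R]_n -> R[i]) -> R[i]) :=
  (forall (a : R[i]) f g, schwartz f -> schwartz g ->
     u (fun x => a * f x + g x) = a * u f + u g) /\
  schwartz_continuous u.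

(** ** Cubes and BMO *)

Definition vol (A : set 'rV[R]_n) : R := fine (mu A).

Definition is_cube (Q : set 'rV[R]_n) :=
  exists (c : 'rV[R]_n) (l : R), 0 < l /\
    Q = [set x | forall i, c ord0 i <= x ord0 i <= c ord0 i + l].

Definition average f (Q : set 'rV[R]_n) : R[i] :=
  ((vol Q)^-1)%:C%C * cintegral mu Q f.

Definition oscillation f (Q : set 'rV[R]_n) : \bar R :=
  (((vol Q)^-1)%:E * \int[mu]_(x in Q) (cabs (f x - average f Q))%:E)%E.

Definition BMO f :=
  loc_integrable f /\ (ereal_sup [set oscillation f Q | Q in is_cube] < +oo)%E.

(** ** Atoms *)

(* [N] is the number [N_E] *)
Definition is_scale (E : set 'rV[R]_n) (N : int) :=
  2 ^ N * vol E <= 1 /\ forall M : int, 2 ^ M * vol E <= 1 -> M <= N.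

Definition A1_on (E : set 'rV[R]_n) : set ('rV[R]_n -> R[i]) :=
  [set a | [/\ cmeasurable setT a,
               csupp a `<=` E,
               exists2 N, is_scale E N & (Lp_norm +oo a <= (2 ^ N)%:E)%E &
               cintegral mu setT a = 0]].

Definition A10_on (E : set 'rV[R]_n) : set ('rV[R]_n -> R[i]) :=
  [set a | exists G H F : set 'rV[R]_n,
    [/\ is_cube G /\ G `<=` E,
        is_cube H /\ H `<=` E,
        G `&` H = set0,
        [/\ measurable F, F `<=` H & mu F = mu G] &
        a = fun x => ((vol E)^-1 * (\1_F x - \1_G x))%:C%C]].

Definition A1 : set ('rV[R]_n -> R[i]) := \bigcup_(E in is_cube) A1_on E.

Definition A10 : set ('rV[R]_n -> R[i]) := \bigcup_(E in is_cube) A10_on E.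

End Rn.
End complex_functions.

(** * Calderon-Zygmund operators *)

(* An operator [T] comes with
   - [pairing f g], the value [<Tf, g>] of the distribution [Tf] at [g], for
     Schwartz functions [f] and [g];
   - the function [kern x y = K(x, y)] of its kernel off the diagonal, whose
     values on the diagonal are irrelevant;
   - the functions [act f = Tf] and [act_tr f = T^* f] for bounded compactly
     supported [f]. *)
Record operator (R : realType) (n : nat) := Operator {
  pairing : ('rV[R]_n -> R[i]) -> ('rV[R]_n -> R[i]) -> R[i];
  kern : 'rV[R]_n -> 'rV[R]_n -> R[i];
  act : ('rV[R]_n -> R[i]) -> 'rV[R]_n -> R[i];
  act_tr : ('rV[R]_n -> R[i]) -> 'rV[R]_n -> R[i] }.

Definition transpose (R : realType) (n : nat) (T : operator R n) :=
  Operator (fun f g => pairing T g f) (fun x y => kern T y x)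
           (act_tr T) (act T).

Section calderon_zygmund.
Context {R : realType} {n : nat}.
Implicit Types (T : operator R n) (f g : 'rV[R]_n -> R[i]) (x y : 'rV[R]_n).

Local Notation mu := (lebesgue_rV n).
Local Notation mu2 := (mu \x mu)%E.

(* [S'] carries its weak-* topology. *)
Definition schwartz_operator T :=
  (forall f, schwartz f -> tempered (pairing T f)) /\
  (forall g, schwartz g -> tempered (pairing T ^~ g)).

Definition off_diagonal : set ('rV[R]_n * 'rV[R]_n) := [set p | p.1 != p.2].

(* [R^n * R^n] is identified with [R^(n+n)]: [x = lsubmx z], [y = rsubmx z].
   [kd] is the kernel distribution, [<Tf, g> = <kd, g(x) f(y)>]. *)
Definition has_kernel T :=
  [/\ cmeasurable off_diagonal (fun p => kern T p.1 p.2),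
      forall A, compact A -> A `<=` off_diagonal ->
        cintegrable mu2 A (fun p => kern T p.1 p.2) &
      exists kd : ('rV[R]_(n + n) -> R[i]) -> R[i],
      [/\ tempered kd,
          forall f g, schwartz f -> schwartz g ->
            pairing T f g = kd (fun z => g (lsubmx z) * f (rsubmx z)) &
          forall phi, test_function phi ->
            (forall z, csupp phi z -> lsubmx z != rsubmx z) ->
            kd phi = cintegral mu2 setT
              (fun p => kern T p.1 p.2 * phi (row_mx p.1 p.2))]].

Definition size_condition T :=
  (ereal_sup [set \int[mu]_(y in [set y | (q.2 <= enorm (q.1 - y) <= 2 * q.2)%R])
                    (cabs (kern T q.1 y) + cabs (kern T y q.1))%:E |
              q in [set q : 'rV[R]_n * R | (0 < q.2)%R]] < +oo)%E.

Definition hormander_condition T :=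
  (ereal_sup [set \int[mu]_(y in [set y |
                     (enorm (q.1 - y) >= 2 * enorm (q.1 - q.2))%R])
                    (cabs (kern T q.1 y - kern T q.2 y) +
                     cabs (kern T y q.1 - kern T y q.2))%:E |
              q in [set: 'rV[R]_n * 'rV[R]_n]] < +oo)%E.

(* [<T1, phi> = <T eta, phi> + <1 - eta, T^* phi>] for [phi] of mean zero and
   [eta = 1] near the support of [phi]. *)
Definition T1_pairing T (eta phi : 'rV[R]_n -> R[i]) : R[i] :=
  pairing T eta phi +
  cintegral mu setT (fun y =>
    (1 - eta y) * cintegral mu setT (fun x => kern T x y * phi x)).

Definition T1_in_BMO T :=
  exists2 b, BMO b &
  forall phi eta, test_function phi -> cintegral mu setT phi = 0 ->
    test_function eta ->
    (exists2 U, open U & csupp phi `<=` U /\ {in U, forall x, eta x = 1}) ->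
    T1_pairing T eta phi = cintegral mu setT (fun x => b x * phi x).

(* [C^1_0(B(u, t))] *)
Definition C10_ball (u : 'rV[R]_n) (t : R) f :=
  [/\ C1 f, compact (csupp f) & csupp f `<=` [set x | enorm (x - u) < t]].

Definition bump_norm (t : R) f : \bar R :=
  (Lp_norm +oo f + t%:E * 'N[mu]_+oo [EFin \o grad_norm f])%E.

(* A function [f] in [C^1_0] need not be a Schwartz function; [Tf] is then
   [act T f], and [<Tf, g>] is meaningful when it converges absolutely. *)
Definition weakly_bounded T :=
  exists c : R, forall (u : 'rV[R]_n) (t : R) f g, 0 < t ->
    C10_ball u t f -> C10_ball u t g ->
    cintegrable mu setT (fun x => act T f x * g x) ->
    ((cabs (cintegral mu setT (fun x => act T f x * g x)))%:E <=
       (c * t ^+ n)%:E * bump_norm t f * bump_norm t g)%E.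

Definition HCZ T :=
  [/\ schwartz_operator T /\ has_kernel T,
      size_condition T,
      hormander_condition T,
      T1_in_BMO T /\ T1_in_BMO (transpose T) &
      weakly_bounded T].

Definition bounded_csupp f :=
  [/\ cmeasurable setT f, (Lp_norm +oo f < +oo)%E & compact (csupp f)].

Definition acts T :=
  [/\ forall f, bounded_csupp f -> cmeasurable setT (act T f),
      forall (a : R[i]) f g, bounded_csupp f -> bounded_csupp g ->
        {ae mu, forall x, act T (fun z => a * f z + g z) x =
                          a * act T f x + act T g x},
      (* the distribution [Tf] is the function [act T f] *)
      forall f, test_function f -> loc_integrable (act T f) /\
        forall g, test_function g ->
          pairing T f g = cintegral mu setT (fun x => act T f x * g x) &
      forall f, bounded_csupp f ->
        {ae mu, forall x, ~ csupp f x ->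
          act T f x = cintegral mu setT (fun y => kern T x y * f y)}].

Definition acts_on_bounded T :=
  [/\ acts T, acts (transpose T) &
      forall f g, bounded_csupp f -> bounded_csupp g ->
        cintegrable mu setT (fun x => act T f x * g x) ->
        cintegrable mu setT (fun x => f x * act_tr T g x) ->
        cintegral mu setT (fun x => act T f x * g x) =
        cintegral mu setT (fun x => f x * act_tr T g x)].

End calderon_zygmund.

(* Main.v *)
(* Fix a bounded [f] of compact support and a cube [Q] with corner [c], and split
   [f = f1 + f2] with [f1] supported in a fixed dilate [Q*] of [Q].  By the
   Hoermander condition [T f2] differs on [Q] from the constant
   [c_Q = int K(c, y) f2(y) dy] by a bounded amount.  Adding to [f1] a bounded
   function [b] supported away from [Q], on which the size condition applies,
   turns it into a multiple of an atom (characteristic, if [f] is a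
   characteristic function), so that [T f1] is controlled by the weak type
   hypothesis.  Hence [|T f - c_Q|] exceeds a fixed constant only on a small
   proportion of each cube [Q], and the John-Stromberg stopping time argument
   gives [int_Q |T f - c_Q| <= C |Q|].  When [f] is supported in [E] and [Q] is a
   large enough dilate of [E], [c_Q = 0]; the complement of [Q] is handled by the
   Hoermander condition and the vanishing mean of the atom. *)

(* A bound $W/\lambda$ on level sets is not integrable in $\lambda$ at infinity, so the weak type
   hypothesis cannot be summed directly. It can be used because, once localised, it holds on cubes
   of every position and size with the same constants: the stopping time then improves it to
   geometric decay of the level sets, which is summable. Localising has a price: cutting a function
   off destroys the vanishing mean (for characteristic atoms, the equality of measures) that makes
   it an atom, and [b] restores it with only a bounded error on $Q$. As $Tf$ is not known to be
   locally integrable in advance, its oscillation is measured through level sets and from the kernel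
   integrals $c_Q$, never from averages of $Tf$. For characteristic atoms the near part is estimated
   for the two indicators separately, whereas the far part needs their difference, whose mean
   vanishes. *)
Require Import Defs.
From mathcomp Require Import all_boot all_order all_algebra.
From mathcomp Require Import all_classical all_reals all_analysis.
From mathcomp Require Import measurable_realfun ess_sup_inf complex ring lra.

Set Implicit Arguments.
Unset Strict Implicit.
Unset Printing Implicit Defensive.

Import Order.TTheory GRing.Theory Num.Theory.
Import numFieldNormedType.Exports.

Local Open Scope classical_set_scope.
Local Open Scope ring_scope.

(** * Complex-valued functions *)

Section complex_abs.
Context {R : realType}.
Implicit Types z w : R[i].

Lemma cabsE z : cabs z = Num.sqrt (complex.Re z ^+ 2 + complex.Im z ^+ 2).
Proof. by case: z. Qed.

Lemma cabs_ge0 z : 0 <= cabs z.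
Proof. by rewrite cabsE sqrtr_ge0. Qed.

Lemma cabs0 : cabs (0 : R[i]) = 0.
Proof. exact: ComplexField.Normc.normc0. Qed.

Lemma cabsM z w : cabs (z * w) = cabs z * cabs w.
Proof. exact: ComplexField.Normc.normcM. Qed.

Lemma ler_cabsD z w : cabs (z + w) <= cabs z + cabs w.
Proof. exact: le_normcD. Qed.

Lemma cabsN z : cabs (- z) = cabs z.
Proof. exact: normcN. Qed.

Lemma cabs_real (r : R) : cabs r%:C%C = `|r|.
Proof. by rewrite cabsE /= expr0n addr0 sqrtr_sqr. Qed.

Lemma ler_cabsB z w : cabs (z - w) <= cabs z + cabs w.
Proof. by rewrite (le_trans (ler_cabsD _ _))// cabsN. Qed.

Lemma ler_cabs_dist z w u : cabs (z - w) <= cabs (u - z) + cabs (u - w).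
Proof.
have -> : z - w = (u - w) - (u - z) by rewrite opprB [RHS]addrC addrA subrK.
by rewrite (le_trans (ler_cabsB _ _))// addrC.
Qed.

Lemma normr_Re_le z : `|complex.Re z| <= cabs z.
Proof. by rewrite -sqrtr_sqr cabsE ler_wsqrtr// lerDl sqr_ge0. Qed.

Lemma normr_Im_le z : `|complex.Im z| <= cabs z.
Proof. by rewrite -sqrtr_sqr cabsE ler_wsqrtr// lerDr sqr_ge0. Qed.

Lemma cabs_le_ReIm z : cabs z <= `|complex.Re z| + `|complex.Im z|.
Proof.
rewrite cabsE -(@ger0_norm _ (`|_| + `|_|))// -sqrtr_sqr ler_wsqrtr//.
rewrite sqrrD !real_normK ?num_real// -addrA lerD2l lerDr.
by rewrite mulrn_wge0// mulr_ge0.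
Qed.

Lemma ReM z w : complex.Re (z * w) =
  complex.Re z * complex.Re w - complex.Im z * complex.Im w.
Proof. by case: z => a b; case: w. Qed.

Lemma ImM z w : complex.Im (z * w) =
  complex.Re z * complex.Im w + complex.Im z * complex.Re w.
Proof. by case: z => a b; case: w. Qed.

Lemma ReD z w : complex.Re (z + w) = complex.Re z + complex.Re w.
Proof. by case: z => a b; case: w. Qed.

Lemma ImD z w : complex.Im (z + w) = complex.Im z + complex.Im w.
Proof. by case: z => a b; case: w. Qed.

Lemma ReN z : complex.Re (- z) = - complex.Re z.
Proof. by case: z. Qed.

Lemma ImN z : complex.Im (- z) = - complex.Im z.
Proof. by case: z. Qed.

End complex_abs.

Section complex_measurable.
Context {R : realType} d (T : measurableType d).
Implicit Types (f g : T -> R[i]) (D : set T).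

Lemma cmeasurable_cst D (z : R[i]) : cmeasurable D (fun=> z).
Proof. by split; exact: measurable_cst. Qed.

Lemma cmeasurable_real D (f : T -> R) : measurable_fun D f ->
  cmeasurable D (fun x => (f x)%:C%C).
Proof. by move=> mf; split => //; exact: measurable_cst. Qed.

Lemma cmeasurableD D f g : cmeasurable D f -> cmeasurable D g ->
  cmeasurable D (fun x => f x + g x).
Proof.
move=> [f1 f2] [g1 g2]; split.
- apply: eq_measurable_fun (measurable_funD f1 g1) => x _ /=.
  by rewrite ReD.
- apply: eq_measurable_fun (measurable_funD f2 g2) => x _ /=.
  by rewrite ImD.
Qed.

Lemma cmeasurableN D f : cmeasurable D f -> cmeasurable D (fun x => - f x).
Proof.
move=> [f1 f2]; split.
- apply: eq_measurable_fun (measurableT_comp (@oppr_measurable R setT) f1) => x _.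
  by rewrite /= ReN.
- apply: eq_measurable_fun (measurableT_comp (@oppr_measurable R setT) f2) => x _.
  by rewrite /= ImN.
Qed.

Lemma cmeasurableB D f g : cmeasurable D f -> cmeasurable D g ->
  cmeasurable D (fun x => f x - g x).
Proof. by move=> mf mg; apply: cmeasurableD => //; exact: cmeasurableN. Qed.

Lemma cmeasurableM D f g : cmeasurable D f -> cmeasurable D g ->
  cmeasurable D (fun x => f x * g x).
Proof.
move=> [f1 f2] [g1 g2]; split.
- apply: eq_measurable_fun
    (measurable_funB (measurable_funM f1 g1) (measurable_funM f2 g2)) => x _ /=.
  by rewrite ReM.
- apply: eq_measurable_fun
    (measurable_funD (measurable_funM f1 g2) (measurable_funM f2 g1)) => x _ /=.
  by rewrite ImM.
Qed.

Lemma measurable_cabs D f : cmeasurable D f ->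
  measurable_fun D (fun x => cabs (f x)).
Proof.
move=> [f1 f2].
apply: eq_measurable_fun (measurableT_comp
  (continuous_measurable_fun (@sqrt_continuous R))
  (measurable_funD (measurable_funX 2 f1) (measurable_funX 2 f2))) => x _ /=.
by rewrite cabsE.
Qed.

Lemma measurable_ecabs D f : cmeasurable D f ->
  measurable_fun D (fun x => (cabs (f x))%:E).
Proof. by move=> mf; apply/measurable_EFinP; exact: measurable_cabs. Qed.

Lemma cmeasurable_comp d' (U : measurableType d') (u : U -> T) f :
  measurable_fun setT u -> cmeasurable setT f ->
  cmeasurable setT (fun x => f (u x)).
Proof.
move=> mu [f1 f2]; split.
- exact: (measurableT_comp f1 mu).
- exact: (measurableT_comp f2 mu).
Qed.

Lemma cmeasurableW D f : cmeasurable setT f -> cmeasurable D f.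
Proof. by case=> f1 f2; split; exact: measurable_funTS. Qed.

Lemma cmeasurable_indic D (A : set T) : measurable A ->
  cmeasurable D (fun x => (\1_A x : R)%:C%C).
Proof. by move=> mA; apply: cmeasurable_real; exact: measurable_indic. Qed.

Lemma measurable_cabs_gt f (r : R) : cmeasurable setT f ->
  measurable [set x | cabs (f x) > r].
Proof.
move=> /measurable_cabs mf.
rewrite (_ : [set _ | _] = (fun x => cabs (f x)) @^-1` `]r, +oo[%classic).
  by rewrite -[X in measurable X]setTI; exact: mf.
by apply/seteqP; split => x /=; rewrite in_itv /= andbT.
Qed.

End complex_measurable.

Section complex_integral.
Context {R : realType} d (T : measurableType d) (mu : {measure set T -> \bar R}).
Implicit Types (f g : T -> R[i]) (D : set T).

Lemma cintegrableP D f : measurable D -> cmeasurable D f ->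
  (\int[mu]_(x in D) (cabs (f x))%:E < +oo)%E -> cintegrable mu D f.
Proof.
move=> mD mf foo.
have [f1 f2] := mf.
split; apply/integrableP; split => //; try exact/measurable_EFinP.
- apply: le_lt_trans foo; apply: ge0_le_integral => //.
  + by do 2 apply: measurableT_comp => //; exact/measurable_EFinP.
  + exact: measurable_ecabs.
  + by move=> x _; rewrite lee_fin normr_Re_le.
- apply: le_lt_trans foo; apply: ge0_le_integral => //.
  + by do 2 apply: measurableT_comp => //; exact/measurable_EFinP.
  + exact: measurable_ecabs.
  + by move=> x _; rewrite lee_fin normr_Im_le.
Qed.

(* The factor [2] is not optimal: it avoids rotating the integral onto the
   real axis. *)
Lemma cabs_cintegral_le D f : measurable D -> cmeasurable D f ->
  ((cabs (cintegral mu D f))%:E <= 2%:E * \int[mu]_(x in D) (cabs (f x))%:E)%E.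
Proof.
move=> mD mf; have [f1 f2] := mf.
have [foo|] := ltP (\int[mu]_(x in D) (cabs (f x))%:E)%E +oo%E; last first.
  by rewrite leye_eq => /eqP ->; rewrite mulry gtr0_sg// mul1e leey.
have [i1 i2] := cintegrableP mD mf foo.
apply: (@le_trans _ _ (`|\int[mu]_(x in D) (complex.Re (f x))%:E| +
   `|\int[mu]_(x in D) (complex.Im (f x))%:E|)%E).
  rewrite (le_trans (y := (`|complex.Re (cintegral mu D f)| +
    `|complex.Im (cintegral mu D f)|)%:E)) ?lee_fin ?cabs_le_ReIm//.
  rewrite EFinD /= /Rintegral -!abse_EFin !fineK//; exact: integrable_fin_num.
rewrite -[2%R]/(1 + 1)%R EFinD ge0_muleDl ?lee_fin// !mul1e leeD//.
- apply: le_trans (le_abse_integral _ mD _) _; first exact/measurable_EFinP.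
  apply: ge0_le_integral => //.
  + by do 2 apply: measurableT_comp => //; exact/measurable_EFinP.
  + exact: measurable_ecabs.
  + by move=> x _; rewrite lee_fin normr_Re_le.
- apply: le_trans (le_abse_integral _ mD _) _; first exact/measurable_EFinP.
  apply: ge0_le_integral => //.
  + by do 2 apply: measurableT_comp => //; exact/measurable_EFinP.
  + exact: measurable_ecabs.
  + by move=> x _; rewrite lee_fin normr_Im_le.
Qed.

Lemma cintegralB D f g : measurable D -> cintegrable mu D f ->
  cintegrable mu D g ->
  cintegral mu D (fun x => f x - g x) = cintegral mu D f - cintegral mu D g.
Proof.
move=> mD [f1 f2] [g1 g2]; apply/eqP; rewrite eq_complex /=; apply/andP; split.
  apply/eqP; rewrite -RintegralB//; apply: eq_Rintegral => x _.
  by rewrite ReD ReN.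
apply/eqP; rewrite -RintegralB//; apply: eq_Rintegral => x _.
by rewrite ImD ImN.
Qed.

Lemma eq_cintegral D f g : (forall x, D x -> f x = g x) ->
  cintegral mu D f = cintegral mu D g.
Proof.
move=> fg; congr Complex; apply: eq_Rintegral => x /set_mem Dx;
  by rewrite fg.
Qed.

Lemma cintegralMl D (c : R[i]) f : measurable D -> cintegrable mu D f ->
  cintegral mu D (fun x => c * f x) = c * cintegral mu D f.
Proof.
move=> mD [f1 f2]; case: c => a b; apply/eqP; rewrite eq_complex /=.
have iZ (h : T -> R) (k : R) : mu.-integrable D (EFin \o h) ->
    mu.-integrable D (EFin \o (fun x => k * h x)).
  move=> ih; rewrite (_ : _ \o _ = fun x => k%:E * (EFin \o h) x)%E//.
  exact: integrableZl.
apply/andP; split; apply/eqP; rewrite -!RintegralZl//.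
- rewrite -RintegralB//; [|exact: iZ..].
  by apply: eq_Rintegral => x _; rewrite ReM.
- rewrite -RintegralD//; [|exact: iZ..].
  by apply: eq_Rintegral => x _; rewrite ImM.
Qed.

End complex_integral.

(** * Dyadic cubes and the John-Stromberg inequality *)

Section boxes.
Context {R : realType}.

(** Half-open, so that the dyadic cubes of one generation partition the space exactly, with no
    boundaries to discard; the closed [ccube] is the shape that [is_cube] asks for. *)
Definition hcube n (c : 'rV[R]_n) (l : R) : set 'rV[R]_n :=
  [set x | forall i, c ord0 i <= x ord0 i < c ord0 i + l].

Definition ccube n (c : 'rV[R]_n) (l : R) : set 'rV[R]_n :=
  [set x | forall i, c ord0 i <= x ord0 i <= c ord0 i + l].

Lemma measurable_coord_set n (P : 'I_n -> set R) :
  (forall i, measurable (P i)) ->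
  measurable [set x : 'rV[R]_n | forall i, P i (x ord0 i)].
Proof.
move=> mP; rewrite (_ : mkset _ = \bigcap_(i in [set: 'I_n])
    (rV_coord i @^-1` P i)); last first.
  by apply/seteqP; split=> x /= h i; [move=> _; exact: h|exact: h].
apply: fin_bigcap_measurable; first exact: finite_finset.
move=> i _; rewrite -[X in measurable X]setTI.
exact: measurable_rV_coord.
Qed.

Lemma measurable_hcube n (c : 'rV[R]_n) l : measurable (hcube c l).
Proof.
rewrite (_ : hcube c l =
    [set x | forall i, `[c ord0 i, c ord0 i + l[%classic (x ord0 i)]).
  apply: (@measurable_coord_set n
    (fun i => `[c ord0 i, c ord0 i + l[%classic)) => i; exact: measurable_itv.
by apply/seteqP; split => x h i; have := h i; rewrite /= in_itv.
Qed.

Lemma measurable_ccube n (c : 'rV[R]_n) l : measurable (ccube c l).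
Proof.
rewrite (_ : ccube c l =
    [set x | forall i, `[c ord0 i, c ord0 i + l]%classic (x ord0 i)]).
  apply: (@measurable_coord_set n
    (fun i => `[c ord0 i, c ord0 i + l]%classic)) => i; exact: measurable_itv.
by apply/seteqP; split => x h i; have := h i; rewrite /= in_itv.
Qed.

Lemma lebesgue_ccube n (c : 'rV[R]_n) l : 0 <= l ->
  lebesgue_rV n (ccube c l) = (l ^+ n)%:E.
Proof.
move=> l0.
pose b : 'rV[R]_n := \row_i (c ord0 i + l).
have -> : ccube c l = [set x | forall i, c ord0 i <= x ord0 i <= b ord0 i].
  by apply/seteqP; split => x h i; have := h i; rewrite mxE.
rewrite lebesgue_rV_box => [|i]; last by rewrite mxE lerDl.
congr (_%:E); under eq_bigr do rewrite mxE addrC addKr.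
by rewrite prodr_const card_ord.
Qed.

Lemma lebesgue_hcube n (c : 'rV[R]_n) l : 0 <= l ->
  lebesgue_rV n (hcube c l) = (l ^+ n)%:E.
Proof.
move=> l0; elim: n c => [|n IH] c.
  by rewrite expr0 /= diracE mem_set//; case.
rewrite /= /lebesgue_cons /pushforward.
pose c' := (rV_uncons c).2.
set X := (X in product_measure1 _ _ X).
have -> : X = `[c ord0 ord0, c ord0 ord0 + l[%classic `*` hcube c' l.
  apply/seteqP; split=> -[t y]; rewrite /X /=.
    move=> h; split.
      by have := h ord0; rewrite mxE unlift_none in_itv.
    by move=> i; have := h (lift ord0 i); rewrite !mxE liftK.
  move=> [ht hy] i; rewrite mxE; case: unliftP => [k ->|->] /=.
    by have := hy k; rewrite !mxE.
  by move: ht; rewrite in_itv.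
rewrite product_measure1E; [|exact: measurable_itv|exact: measurable_hcube].
rewrite IH exprS EFinM; congr (_ * _)%E.
transitivity (@lebesgue_measure R `[c ord0 ord0, c ord0 ord0 + l[%classic) => [//|].
rewrite lebesgue_measure_itv /= lte_fin.
case: ltP => [_|ba]; first by rewrite -EFinB addrC addKr.
by congr (_%:E); apply/eqP; rewrite eq_le l0 -(lerD2l (c ord0 ord0)) addr0.
Qed.

End boxes.

(** * Dyadic grids and approximation of Borel sets by unions of dyadic cubes *)

Section dyadic.
Context {R : realType} {n : nat}.
Variables (c : 'rV[R]_n) (l : R).
Hypothesis l0 : 0 < l.
Local Notation mu := (lebesgue_rV n).
Implicit Types (x y : 'rV[R]_n) (m : 'rV[int]_n) (A B S : set 'rV[R]_n).

(** The grid of mesh $l/2^k$ anchored at [c] covers the whole space, not just one cube. Coding its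
    cubes by integer vectors turns membership into an equation between indices and gives
    countability. *)
Definition dyadic_index k x : 'rV[int]_n :=
  \row_i Num.floor ((x ord0 i - c ord0 i) / (l / 2 ^+ k)).

Definition dyadic_corner k m : 'rV[R]_n :=
  \row_i (c ord0 i + (m ord0 i)%:~R * (l / 2 ^+ k)).

Definition dyadic_cube k m : set 'rV[R]_n :=
  hcube (dyadic_corner k m) (l / 2 ^+ k).

(** A union of cubes of generation [k], expressed as invariance under the relation of lying in the
    same cube; complements, unions and refinements then need no enumeration. *)
Definition saturated k S :=
  forall x y, dyadic_index k x = dyadic_index k y -> S x -> S y.

Lemma dyadic_side_gt0 k : 0 < l / 2 ^+ k.
Proof. by rewrite divr_gt0// exprn_gt0. Qed.

Lemma dyadic_cubeP k m x : dyadic_cube k m x <-> dyadic_index k x = m.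
Proof.
have lk := dyadic_side_gt0 k.
have floorP i : (dyadic_corner k m ord0 i <= x ord0 i
      < dyadic_corner k m ord0 i + l / 2 ^+ k) =
    (Num.floor ((x ord0 i - c ord0 i) / (l / 2 ^+ k)) == m ord0 i).
  rewrite floor_eq mxE ler_pdivlMr// ltr_pdivrMr// intrD mulrDl mul1r.
  by rewrite lerBrDl ltrBlDl addrA.
split=> [h|h i].
  by apply/rowP => i; rewrite mxE; apply/eqP; rewrite -floorP; exact: h.
by rewrite floorP -h mxE.
Qed.

(** Nesting of the grids: $\lfloor 2u\rfloor$ determines $\lfloor u\rfloor$, because $2\lfloor
    u\rfloor\le\lfloor 2u\rfloor$ and $\lfloor 2u\rfloor+1\le 2(\lfloor u\rfloor+1)$. *)
Lemma dyadic_indexW k x y :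
  dyadic_index k.+1 x = dyadic_index k.+1 y -> dyadic_index k x = dyadic_index k y.
Proof.
move=> /rowP h; apply/rowP => i; have := h i; rewrite !mxE.
have E t : t / (l / 2 ^+ k.+1) = t / (l / 2 ^+ k) * 2.
  by rewrite !invf_div exprS !mulrA; ring.
rewrite !E; set u := (x _ _ - _) / _; set v := (y _ _ - _) / _.
move=> uv; apply/esym/eqP; rewrite floor_eq.
have /andP[u1 u2] := floor_itv u.
have /andP[u3 u4] := floor_itv (u * 2).
have /andP[v3 v4] := floor_itv (v * 2).
rewrite -uv in v3 v4.
set p := Num.floor u in u1 u2 *; set q := Num.floor (u * 2) in u3 u4 v3 v4 *.
have pq : p * 2 <= q.
  rewrite -ltzD1 -(ltr_int R) intrM; apply: le_lt_trans u4.
  by rewrite ler_pM2r.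
have qp : q + 1 <= (p + 1) * 2.
  rewrite lezD1 -(ltr_int R) intrM; apply: le_lt_trans u3 _.
  by rewrite ltr_pM2r.
apply/andP; split.
  rewrite -(@ler_pM2r _ 2)//; apply: le_trans v3.
  by rewrite -(intrM _ _ 2) ler_int.
rewrite -(@ltr_pM2r _ 2)//; apply: lt_le_trans v4 _.
by rewrite -(intrM _ _ 2) ler_int.
Qed.

Lemma dyadic_index_le j k x y : (j <= k)%N ->
  dyadic_index k x = dyadic_index k y -> dyadic_index j x = dyadic_index j y.
Proof.
move=> /subnK <-; elim: (k - j)%N => [|p IH]; first by rewrite add0n.
by rewrite addSn => /dyadic_indexW.
Qed.

Lemma saturated_le j k S : (j <= k)%N -> saturated j S -> saturated k S.
Proof. by move=> jk sS x y /(dyadic_index_le jk)/sS. Qed.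

(** Integer vectors form a countable type, so [pickle] numbers the cubes; a number that codes no
    cube of [S] gives the empty piece. *)
Let pieces k S j : set 'rV[R]_n :=
  [set x | S x /\ choice.pickle (dyadic_index k x) = j].

Let piecesP k S j : saturated k S -> pieces k S j = set0 \/
  exists m, pieces k S j = dyadic_cube k m /\ dyadic_cube k m `<=` S.
Proof.
move=> sS; have [|/set0P[x [Sx <-]]] := eqVneq (pieces k S j) set0.
  by left.
right; exists (dyadic_index k x).
have sub : dyadic_cube k (dyadic_index k x) `<=` S.
  by move=> y /dyadic_cubeP yx; apply: sS Sx.
split => //; apply/seteqP; split => y.
  by move=> [_ /(pcan_inj choice.pickleK) ?]; exact/dyadic_cubeP.
by move=> xy; split; [exact: sub|move/dyadic_cubeP : xy => ->].
Qed.

Let pieces_cup k S : \bigcup_j pieces k S j = S.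
Proof.
apply/seteqP; split => [x [j _ []]//|x Sx].
by exists (choice.pickle (dyadic_index k x)).
Qed.

Let pieces_triv k S : trivIset setT (pieces k S).
Proof.
apply/trivIsetP => i j _ _ /eqP ij; apply/seteqP; split => // x [[_ xi] [_ xj]].
by apply: ij; rewrite -xi.
Qed.

Let pieces_measurable k S j : saturated k S -> measurable (pieces k S j).
Proof.
by move=> /(piecesP j)[->|[m [-> _]]] //; exact: measurable_hcube.
Qed.

Lemma saturated_measurable k S : saturated k S -> measurable S.
Proof.
move=> sS; rewrite -(pieces_cup k S); apply: bigcupT_measurable => j.
exact: pieces_measurable.
Qed.

(** Countable additivity over the cubes that make up [S]: a comparison made cube by cube adds up. *)
Lemma saturated_measure_le k S A B (t : R) : 0 <= t ->
  measurable A -> measurable B -> saturated k S ->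
  (forall m, dyadic_cube k m `<=` S ->
    (mu (A `&` dyadic_cube k m) <= t%:E * mu (B `&` dyadic_cube k m))%E) ->
  (mu (A `&` S) <= t%:E * mu (B `&` S))%E.
Proof.
move=> t0 mA mB sS h.
have decomp C : measurable C ->
    mu (C `&` S) = (\sum_(0 <= j <oo) mu (C `&` pieces k S j))%E.
  move=> mC; rewrite -{1}(pieces_cup k S) setI_bigcupr measure_bigcup//=.
  - by apply: eq_eseriesl => j; rewrite in_setT.
  - by move=> j _; apply: measurableI => //; exact: pieces_measurable.
  - exact/trivIset_setIl/pieces_triv.
rewrite !decomp// -nneseriesZl//; apply: lee_nneseries => // j _.
have [->|[m [-> sub]]] := piecesP j sS; last exact: h.
by rewrite !setI0 measure0 mule0.
Qed.

Local Notation Q := (hcube c l).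

(** The union of the two differences is the symmetric difference of [A] and [S]. The measurable sets
    with this property turn out to be closed under complements and countable unions. *)
Definition dyadic_approx A := forall e : R, 0 < e ->
  exists k S, saturated k S /\
  (mu (Q `&` ((A `\` S) `|` (S `\` A))) <= e%:E)%E.

Let mQ : measurable Q. Proof. exact: measurable_hcube. Qed.

Lemma saturated_approx k S : saturated k S -> dyadic_approx S.
Proof.
move=> sS e e0; exists k, S; split => //.
by rewrite setDv setU0 setI0 measure0 lee_fin ltW.
Qed.

Lemma dyadic_approxC A : dyadic_approx A -> dyadic_approx (~` A).
Proof.
move=> aA e /aA[k [S [sS le]]]; exists k, (~` S); split.
  by move=> x y xy; apply: contra_not; exact: sS.
rewrite (_ : _ `|` _ = (A `\` S) `|` (S `\` A))//.
rewrite setDE setCK setDE setCK setUC; congr (_ `|` _).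
- by rewrite setIC setDE.
- by rewrite setIC setDE.
Qed.

Lemma dyadic_approxU A B : measurable A -> measurable B ->
  dyadic_approx A -> dyadic_approx B -> dyadic_approx (A `|` B).
Proof.
move=> mA mB aA aB e e0; have e20 : 0 < e / 2 by rewrite divr_gt0.
have [k [S [sS leS]]] := aA _ e20; have [j [U [sU leU]]] := aB _ e20.
exists (maxn k j), (S `|` U); split.
  move=> x y xy [Sx|Ux]; [left|right].
  - exact: (saturated_le (leq_maxl k j) sS) Sx.
  - exact: (saturated_le (leq_maxr k j) sU) Ux.
have mS := saturated_measurable sS; have mU := saturated_measurable sU.
rewrite (_ : e = e / 2 + e / 2); last exact: splitr.
rewrite EFinD; apply: le_trans (leeD leS leU).
apply: le_trans (measureU2 _ _ _) => //.
- apply: le_measure; rewrite ?inE//; first 1 last.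
  + apply: measurableU; apply: measurableI => //;
      by apply: measurableU; apply: measurableD.
  + move=> x [Qx [[[Ax|Bx] /not_orP[nS nU]]|[[Sx|Ux] /not_orP[nA nB]]]].
    * by left; split => //; left.
    * by right; split => //; left.
    * by left; split => //; right.
    * by right; split => //; right.
  + apply: measurableI => //.
    by apply: measurableU; apply: measurableD => //; apply: measurableU.
- by apply: measurableI => //; apply: measurableU; apply: measurableD.
- by apply: measurableI => //; apply: measurableU; apply: measurableD.
Qed.

(** Inside [Q], the part of the union missed by the first [N] sets decreases to the empty set; as
    [Q] has finite measure, some finite union is within [e / 2] of the whole, and a finite union can
    be approximated. *)
Lemma dyadic_approx_bigcup (F : nat -> set 'rV[R]_n) :
  (forall i, measurable (F i)) -> (forall i, dyadic_approx (F i)) ->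
  dyadic_approx (\bigcup_i F i).
Proof.
move=> mF aF e e0; have e20 : 0 < e / 2 by rewrite divr_gt0.
pose G N := \big[setU/set0]_(i < N) F i.
have mG N : measurable (G N) by exact: bigsetU_measurable.
have aG N : dyadic_approx (G N).
  elim: N => [|N IH]; rewrite /G.
    rewrite big_ord0; apply: (@saturated_approx 0); by move=> x y.
  by rewrite big_ord_recr; exact: (dyadic_approxU (mG N) (mF N) IH (aF N)).
have mU : measurable (\bigcup_i F i) by exact: bigcupT_measurable.
pose H N := Q `&` (\bigcup_i F i `\` G N).
have mH N : measurable (H N) by apply: measurableI => //; exact: measurableD.
have Hcvg : mu \o H @ \oo --> mu (\bigcap_N H N).
  apply: nonincreasing_cvg_mu => //.
  - apply: (@le_lt_trans _ _ (mu Q)).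
      by apply: le_measure; rewrite ?inE//; exact: subIsetl.
    by rewrite lebesgue_hcube ?ltry// ltW.
  - by apply: bigcap_measurable => //; exists 0%N.
  - move=> i j ij; apply/subsetPset => x [Qx [Fx nG]]; split => //; split => //.
    apply: contra_not nG; rewrite /G -!bigcup_mkord => -[k /= ki Fk].
    by exists k => //=; exact: leq_trans ij.
have H0 : \bigcap_N H N = set0.
  apply/seteqP; split => // x Hx.
  have [_ [[i _ Fi] _]] := Hx 0%N I.
  have [_ [_ []]] := Hx i.+1 I.
  by rewrite /G -bigcup_mkord; exists i => /=.
rewrite H0 measure0 in Hcvg.
have : \forall N \near \oo, ((mu \o H) N < (e / 2)%:E)%E.
  apply: (Hcvg [set y | (y < (e / 2)%:E)%E]).
  by apply: open_nbhs_nbhs; split; [exact: open_ereal_lt_ereal|rewrite /= lte_fin].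
move=> [N _ /(_ N (leqnn N)) /= HN].
have [k [S [sS leS]]] := aG N _ e20.
have mS := saturated_measurable sS.
exists k, S; split => //.
rewrite (_ : e = e / 2 + e / 2); last exact: splitr.
rewrite EFinD; apply: le_trans (leeD (ltW HN) leS).
apply: le_trans (measureU2 _ _ _) => //; last first.
  by apply: measurableI => //; apply: measurableU; apply: measurableD.
apply: le_measure; rewrite ?inE//.
- by apply: measurableI => //; apply: measurableU; apply: measurableD.
- apply: measurableU => //.
  by apply: measurableI => //; apply: measurableU; apply: measurableD.
- move=> x [Qx [[Fx nS]|[Sx nF]]].
    have [Gx|nG] := pselect (G N x); first by right; split => //; left.
    by left; split.
  right; split => //; right; split => //.
  by apply: contra_not nF; rewrite /G -bigcup_mkord => -[i _ Fi]; exists i.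
Qed.

Lemma ltr_dyadic (e : R) : 0 < e -> exists k, l / 2 ^+ k < e.
Proof.
move=> e0; have le0 : 0 <= l / e by rewrite divr_ge0// ltW.
exists (Num.bound (l / e)); rewrite ltr_pdivrMr ?exprn_gt0// mulrC -ltr_pdivrMr//.
apply: lt_trans (archi_boundP le0) _.
by rewrite -natrX ltr_nat ltn_expl.
Qed.

(** The half-spaces $x_i<t$ generate the Borel sets, and each is the union, over all generations, of
    the dyadic cubes that it contains. *)
Lemma measurable_dyadic_approx A : measurable A -> dyadic_approx A.
Proof.
suff: measurable `<=` [set A | measurable A /\ dyadic_approx A].
  by move=> h /h[].
have sC B : measurable B /\ dyadic_approx B ->
    measurable (~` B) /\ dyadic_approx (~` B).
  by move=> [mB aB]; split; [exact: measurableC|exact: dyadic_approxC].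
have sU (F : nat -> set 'rV[R]_n) :
    (forall i, measurable (F i) /\ dyadic_approx (F i)) ->
    measurable (\bigcup_i F i) /\ dyadic_approx (\bigcup_i F i).
  move=> F_; split; first by apply: bigcupT_measurable => i; have [] := F_ i.
  by apply: dyadic_approx_bigcup => i; have [] := F_ i.
have s0 : measurable (set0 : set 'rV[R]_n) /\ dyadic_approx set0.
  by split => //; apply: (@saturated_approx 0) => x y.
have coord (i : 'I_n) (Y : set R) : measurable Y ->
    measurable (rV_coord i @^-1` Y) /\ dyadic_approx (rV_coord i @^-1` Y).
  rewrite [X in X Y](RGenInftyO.measurableE R).
  have : <<s @RGenInftyO.G R >> `<=` [set Y | measurable (rV_coord i @^-1` Y) /\
      dyadic_approx (rV_coord i @^-1` Y)].
    apply: smallest_sub; first split.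
    - by rewrite /= preimage_set0.
    - by move=> B /= ?; rewrite setTD preimage_setC; exact: sC.
    - by move=> F /= ?; rewrite preimage_bigcup; exact: sU.
    - move=> _ [t ->] /=; split.
        rewrite -[X in measurable X]setTI.
        by apply: measurable_rV_coord => //; exact: measurable_itv.
      pose U k : set 'rV[R]_n := [set x | dyadic_corner k (dyadic_index k x) ord0 i
        + l / 2 ^+ k <= t].
      have sUk k : saturated k (U k) by move=> x y xy; rewrite /U /= xy.
      rewrite (_ : _ @^-1` _ = \bigcup_k U k).
        apply: dyadic_approx_bigcup => k; first exact: saturated_measurable (sUk k).
        exact: saturated_approx (sUk k).
      apply/seteqP; split => x.
        rewrite /= in_itv /= /rV_coord => xt.
        have [k kx] : exists k, l / 2 ^+ k < t - x ord0 i.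
          by apply: ltr_dyadic; rewrite subr_gt0.
        exists k => //=.
        have /dyadic_cubeP/(_ i)/andP[h _] := erefl (dyadic_index k x).
        by move: kx; rewrite ltrBrDl => /ltW; apply: le_trans; rewrite lerD2r.
      move=> [k _ /= h]; rewrite in_itv /= /rV_coord.
      have /dyadic_cubeP/(_ i)/andP[_ h2] := erefl (dyadic_index k x).
      exact: lt_le_trans h.
  by move=> h /h.
rewrite [X in X `<=` _](_ : _ = <<s \big[setU/set0]_(i < n)
    preimage_set_system setT (@rV_coord R n i) measurable >>)//.
apply: smallest_sub; first split => //.
- by move=> B /= ?; rewrite setTD; exact: sC.
- rewrite -bigcup_seq; apply: bigcup_sub => i _ B [Y mY <-].
  by rewrite setTI; exact: coord.
Qed.

End dyadic.

Lemma measure_le_setU2 d (T : measurableType d) (R : realType)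
    (m : {measure set T -> \bar R}) (A B C : set T) :
  measurable A -> measurable B -> measurable C -> A `<=` B `|` C ->
  (m A <= m B + m C)%E.
Proof.
move=> mA mB mC ABC; apply: le_trans (measureU2 _ mB mC).
by apply: le_measure; rewrite ?inE//; exact: measurableU.
Qed.

(** * A dyadic density theorem *)

Section density.
Context {R : realType} {n : nat}.
Variables (c : 'rV[R]_n) (l : R).
Hypothesis l0 : 0 < l.
Local Notation mu := (lebesgue_rV n).
Local Notation Q := (hcube c l).

Lemma dyadic_cube00 : dyadic_cube c l 0 0 = Q.
Proof.
by apply/seteqP; split => x h i; have := h i;
  rewrite !mxE !expr0 divr1 mul0r addr0.
Qed.

Lemma saturated_hcube k : saturated c l k Q.
Proof.
have s0 : saturated c l 0 Q.
  move=> x y xy; rewrite -dyadic_cube00 => /(dyadic_cubeP c l0) x0.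
  by apply/(dyadic_cubeP c l0); rewrite -xy.
exact: (saturated_le (leq0n k) s0).
Qed.

Lemma measure_dyadic_cube k m : mu (dyadic_cube c l k m) = ((l / 2 ^+ k) ^+ n)%:E.
Proof. by apply: lebesgue_hcube; rewrite ltW// dyadic_side_gt0. Qed.

(** This stands in for Lebesgue's density theorem. If a union of dyadic cubes is within $e$ of [A],
    adding up the hypothesis over these cubes gives $|A|\le t(|A|+e)+e$, hence $(1-t)|A|\le 2e$. *)
Lemma dyadic_density (A : set 'rV[R]_n) (t : R) : 0 <= t < 1 -> measurable A ->
  A `<=` Q -> (forall k m, (mu (A `&` dyadic_cube c l k m) <=
    t%:E * mu (dyadic_cube c l k m))%E) -> mu A = 0%E.
Proof.
move=> /andP[t0 t1] mA AQ h.
have mQ : measurable Q := measurable_hcube c l.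
have muQ : mu Q = (l ^+ n)%:E by rewrite lebesgue_hcube// ltW.
have finQ B : measurable B -> B `<=` Q -> mu B \is a fin_num.
  move=> mB BQ; rewrite ge0_fin_numE//; apply: (@le_lt_trans _ _ (mu Q)).
    by apply: le_measure; rewrite ?inE.
  by rewrite muQ ltry.
have key e : 0 < e -> (1 - t) * fine (mu A) <= 2 * e.
  move=> e0.
  have [k [S0 [sS0 le0]]] := measurable_dyadic_approx c l0 mA e0.
  pose S := S0 `&` Q.
  have sS : saturated c l k S.
    move=> x y xy [Sx Qx]; split; first exact: sS0 Sx.
    exact: (@saturated_hcube k) xy Qx.
  have mS0 := saturated_measurable l0 sS0.
  have mS := saturated_measurable l0 sS.
  have mE : measurable (Q `&` ((A `\` S0) `|` (S0 `\` A))).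
    by apply: measurableI => //; apply: measurableU; apply: measurableD.
  have leAS : (mu (A `\` S) <= e%:E)%E.
    apply: le_trans le0; apply: le_measure; rewrite ?inE//; first exact: measurableD.
    move=> x [Ax nS]; split; first exact: AQ.
    by left; split => // Sx; apply: nS; split => //; exact: AQ.
  have leSA : (mu (S `\` A) <= e%:E)%E.
    apply: le_trans le0; apply: le_measure; rewrite ?inE//; first exact: measurableD.
    by move=> x [[Sx Qx] nA]; split => //; right.
  have leS : (mu (A `&` S) <= t%:E * mu S)%E.
    rewrite -[X in (_ <= _ * mu X)%E]setTI.
    apply: (saturated_measure_le l0) sS _ => // m _.
    by rewrite setTI.
  have S_A : (mu S <= mu A + e%:E)%E.
    apply: le_trans (leeD (lexx _) leSA).
    apply: measure_le_setU2 => //; first exact: measurableD.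
    by move=> x Sx; have [Ax|nA] := pselect (A x); [left|right].
  have A_S : (mu A <= t%:E * (mu A + e%:E) + e%:E)%E.
    have : (mu A <= mu (A `&` S) + mu (A `\` S))%E.
      apply: measure_le_setU2 => //; [exact: measurableI|exact: measurableD|].
      by move=> x Ax; have [Sx|nS] := pselect (S x); [left|right].
    move/le_trans; apply; apply: leeD => //.
    by apply: le_trans leS _; rewrite lee_wpmul2l// lee_fin.
  have fA := finQ _ mA AQ.
  move: A_S; rewrite -(fineK fA) -!EFinD lee_fin => A_S.
  by nra.
have : (1 - t) * fine (mu A) <= 0.
  apply/ler_addgt0Pr => e e0; rewrite add0r.
  by have := key (e / 2); rewrite divr_gt0// => /(_ isT); lra.
rewrite pmulr_rle0 ?subr_gt0// => le0.
apply/eqP; rewrite eq_le measure_ge0 andbT -(fineK (finQ _ mA AQ)).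
by rewrite lee_fin.
Qed.

End density.

(** * John-Stromberg: from oscillation in measure to oscillation in mean *)

Section john_stromberg.
Context {R : realType} {n : nat}.
Local Notation mu := (lebesgue_rV n).
Variables (g : 'rV[R]_n -> R[i]) (cc : 'rV[R]_n -> R -> R[i]) (lam : R).
Hypothesis mg : cmeasurable setT g.
Hypothesis lam0 : 0 < lam.

Let dev c l (r : R) : set 'rV[R]_n := [set x | cabs (g x - cc c l) > r].

Let mdev c l r : measurable (dev c l r).
Proof.
apply: (@measurable_cabs_gt _ _ _ (fun x => g x - cc c l)).
by apply: cmeasurableB => //; exact: cmeasurable_cst.
Qed.

(** The proportion $2^{-(n+2)}$ serves twice. It is half of the stopping density $2^{-(n+1)}$, so
    the stopped cubes fill at most half of the cube; and it is at most $1/4$, which leaves a good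
    point in a stopped cube where the bad set of the large cube fills at most $1/2$. *)
Hypothesis osc : forall c l, 0 < l ->
  (mu (hcube c l `&` dev c l lam) <= ((2 ^+ n.+2)^-1 * l ^+ n)%:E)%E.

(* Stopping at the maximal dyadic cubes on which the bad set
   [|g - c_Q| > lam] has density more than [2^-(n+1)]. *)
Lemma john_stromberg_decay k c l : 0 < l ->
  (mu (hcube c l `&` dev c l (2 * lam * k%:R)) <= ((2 ^+ k)^-1 * l ^+ n)%:E)%E.
Proof.
have lamp : 0 < lam := lam0.
have lam2 : lam <= 2 * lam by lra.
elim: k c l => [|k IH] c l l0.
  rewrite expr0 invr1 mul1r -(lebesgue_hcube c (ltW l0)).
  have mQ := measurable_hcube c l.
  by apply: le_measure; rewrite ?inE; [exact: measurableI| |exact: subIsetl].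
set Q := hcube c l.
have mQ : measurable Q := measurable_hcube c l.
pose Om := Q `&` dev c l lam.
have mOm : measurable Om by exact: measurableI.
pose th : R := (2 ^+ n.+1)^-1.
have th0 : 0 < th by rewrite invr_gt0 exprn_gt0.
pose D := dyadic_cube c l.
have mD j m : measurable (D j m) by exact: measurable_hcube.
pose heavy j m := (th%:E * mu (D j m) < mu (Om `&` D j m))%E.
pose hv j x := heavy j (dyadic_index c l j x).
(* Points whose first heavy cube has generation [j], that is, the union of the maximal heavy cubes
   of that generation. *)
pose S j : set 'rV[R]_n := [set x | hv j x /\ forall i, (i < j)%N -> ~ hv i x].
have sS j : saturated c l j (S j).
  move=> x y xy [hx nx]; split; first by rewrite /hv -xy.
  move=> i ij; rewrite /hv -(dyadic_index_le (ltnW ij) xy); exact: nx.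
have mS j := saturated_measurable l0 (sS j).
have tS : trivIset setT S.
  apply/trivIsetP => i j _ _ /eqP ij; apply/seteqP; split => // x [[hi ni] [hj nj]].
  have [lt|lt|//] := ltngtP i j; [exact: nj lt hi|exact: ni lt hj].
have OmQ : (mu Om <= ((2 ^+ n.+2)^-1 * l ^+ n)%:E)%E by exact: osc.
(* All cubes of generation 0 have the volume of [Q], and the threshold is twice the bound on [Om].
   Hence a stopped cube always has a parent. *)
have not_heavy0 m : ~~ heavy 0 m.
  rewrite -leNgt measure_dyadic_cube// expr0 divr1 -EFinM.
  apply: (@le_trans _ _ (mu Om)).
    by apply: le_measure; rewrite ?inE//; exact: measurableI.
  apply: le_trans OmQ _; rewrite lee_fin ler_wpM2r ?exprn_ge0 ?(ltW l0)//.
  by rewrite /th lef_pV2 ?posrE ?exprn_gt0// ler_eXn2l ?ltr1n.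
pose W := Q `&` dev c l (2 * lam * k.+1%:R).
have mW : measurable W by exact: measurableI.
have WOm : W `<=` Om.
  move=> x [Qx dx]; split => //; apply: le_lt_trans dx.
  have H : 0 <= 2 * lam * k%:R by rewrite !mulr_ge0// ltW.
  by rewrite -[k.+1%:R]natr1 mulrDr mulr1 -[leLHS]add0r lerD.
have uS : measurable (\bigcup_j S j) by exact: bigcupT_measurable.
(* A cube that meets this set is not heavy, since otherwise its points would have been stopped; so
   the set has density at most [th] in every dyadic cube. *)
have null : mu (Om `\` \bigcup_j S j) = 0%E.
  apply: (@dyadic_density _ _ c l l0 _ th) => //.
  - rewrite ltW//= invf_lt1 ?exprn_gt0// exprn_egt1 ?ltr1n//.
  - exact: measurableD.
  - by move=> x [[]].
  - move=> j m; have [->|/set0P[x [[Omx nS] xD]]] :=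
        eqVneq ((Om `\` \bigcup_j S j) `&` D j m) set0.
      by rewrite measure0 mule_ge0// lee_fin ltW.
    have nh : ~~ heavy j m.
      apply/negP => hj; apply: nS.
      have : exists i, hv i x.
        by exists j; rewrite /hv; move/(dyadic_cubeP c l0) : xD => ->.
      move=> ex; have ex' : exists i, `[< hv i x >].
        by move: ex => [i ?]; exists i; exact/asboolP.
      exists (ex_minn ex') => //; case: ex_minnP => i /asboolP hi mini; split => //.
      by move=> p pi hp; have := mini p (asboolT hp); rewrite leqNgt pi.
    move: nh; rewrite -leNgt; apply: le_trans.
    apply: le_measure; rewrite ?inE; [|exact: measurableI|].
      by apply: measurableI => //; exact: measurableD.
    by apply: setSI; exact: subDsetl.
have cubeS j m : D j m `<=` S j ->
    (mu (W `&` D j m) <= ((2 ^+ k)^-1)%:E * mu (setT `&` D j m))%E /\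
    (mu (setT `&` D j m) <= (2 ^+ n.+1)%:E * mu (Om `&` D j m))%E.
  move=> DS; rewrite setTI.
  (* The corner belongs to the half-open cube and serves as its representative. *)
  pose x := dyadic_corner c l j m.
  have lj := dyadic_side_gt0 l0 j.
  have xD : D j m x by move=> i; rewrite lexx ltrDl.
  have [hx nx] := DS _ xD.
  have xm : dyadic_index c l j x = m by exact/(dyadic_cubeP c l0).
  have hm : heavy j m by rewrite -xm.
  split; last first.
    have thE : th * 2 ^+ n.+1 = 1 by rewrite mulVf// expf_neq0.
    by rewrite -(@lee_pmul2l _ th%:E) ?lte_fin// muleA -EFinM thE mul1e ltW.
  (* A heavy cube meets [Q], which is itself a union of cubes of that generation. *)
  have DQ : D j m `<=` Q.
    have : (0 < mu (Om `&` D j m))%E.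
      by apply: le_lt_trans hm; rewrite mule_ge0// lee_fin ltW.
    move=> pos; have [y [[Qy _] yD]] : (Om `&` D j m) !=set0.
      by apply/set0P; apply: contraTneq pos => ->; rewrite measure0 ltxx.
    move=> z zD; apply: (@saturated_hcube _ _ c l l0 j y z) => //.
    by move/(dyadic_cubeP c l0) : yD => ->; move/(dyadic_cubeP c l0) : zD => ->.
  pose c' := dyadic_corner c l j m; pose l' := l / 2 ^+ j.
  have muD : mu (D j m) = (l' ^+ n)%:E by exact: measure_dyadic_cube.
  have l'n : 0 < l' ^+ n by rewrite exprn_gt0.
  (* The parent is not heavy and has $2^n$ times the volume, so its density bound $2^{-(n+1)}$
     becomes $1/2$ in the child. *)
  have half : (mu (Om `&` D j m) <= (2^-1 * l' ^+ n)%:E)%E.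
    have j0 : (0 < j)%N.
      by rewrite lt0n; apply/eqP => j0; have := not_heavy0 m; move: hm; rewrite j0 => ->.
    pose p := j.-1; pose m' := dyadic_index c l p x.
    have : ~~ heavy p m' by apply/negP; apply: nx; rewrite prednK.
    rewrite -leNgt => nh; apply: (@le_trans _ _ (mu (Om `&` D p m'))).
      apply: le_measure; rewrite ?inE; [exact: measurableI|exact: measurableI|].
      move=> z [Omz zD]; split => //; apply/(dyadic_cubeP c l0).
      apply: (dyadic_index_le (leq_pred j)); rewrite xm.
      exact/(dyadic_cubeP c l0).
    apply: le_trans nh _; rewrite measure_dyadic_cube// -EFinM lee_fin.
    have -> : l' = l / 2 ^+ p / 2.
      by rewrite /l' -(prednK j0) -/p exprSr invfM mulrA.
    rewrite (expr_div_n (l / 2 ^+ p) 2) /th exprSr.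
    rewrite le_eqVlt; apply/orP; left; apply/eqP.
    have : (2 : R) ^+ n != 0 by rewrite expf_neq0.
    by set a := (l / _) ^+ n; move: (2 ^+ n) => b b0; field; exact: b0.
  have oscD : (mu (D j m `&` dev c' l' lam) <= ((2 ^+ n.+2)^-1 * l' ^+ n)%:E)%E.
    exact: osc.
  (* The two bad sets fill at most $1/2+1/4$ of the cube, so some point is good for both centres,
     which are then at distance at most $2\lambda$. Replacing the centre of [Q] by that of the
     stopped cube therefore costs one level. *)
  have : exists2 y, D j m y & ~ (Om y) /\ ~ dev c' l' lam y.
    apply: contrapT => no.
    have : (mu (D j m) <= mu (Om `&` D j m) + mu (D j m `&` dev c' l' lam))%E.
      apply: measure_le_setU2 => //; [exact: measurableI..|].
      move=> y yD; have [Omy|nOm] := pselect (Om y); first by left.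
      right; split => //; apply: contrapT => nd; apply: no; by exists y.
    apply/negP; rewrite -ltNge; apply: le_lt_trans (leeD half oscD) _.
    rewrite muD -EFinD lte_fin -mulrDl -/l' gtr_pMl//.
    have : (2 ^+ n.+2)^-1 <= 4^-1 :> R.
      rewrite lef_pV2 ?posrE ?exprn_gt0// !exprS mulrA -[X in X <= _]mulr1.
      by rewrite -natrM ler_pM2l// exprn_ege1// ler1n.
    by lra.
  move=> [y yD [nOm /negP]]; rewrite -leNgt => dy'.
  have dy : cabs (g y - cc c l) <= lam.
    rewrite leNgt; apply/negP => dy; apply: nOm; split => //; exact: DQ.
  have close : cabs (cc c' l' - cc c l) <= 2 * lam.
    apply: le_trans (ler_cabs_dist _ _ (g y)) _; lra.
  apply: (@le_trans _ _ (mu (D j m `&` dev c' l' (2 * lam * k%:R)))).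
    apply: le_measure; rewrite ?inE; [exact: measurableI|exact: measurableI|].
    move=> z [[_ dz] zD]; split => //; move: dz; rewrite /dev /= => dz.
    have : cabs (g z - cc c l) <= cabs (g z - cc c' l') + cabs (cc c' l' - cc c l).
      by apply: le_trans (ler_cabsD _ _); rewrite addrA subrK.
    by move: dz; rewrite -[k.+1%:R]natr1 mulrDr mulr1; lra.
  by rewrite muD -EFinM; exact: IH.
have -> : Q `&` dev c l (2 * lam * k.+1%:R) = W by [].
apply: (@le_trans _ _ (mu (W `&` \bigcup_j S j))).
  rewrite -[leRHS]adde0 -[X in (_ + X)%E]null.
  apply: measure_le_setU2 => //; [exact: measurableI|exact: measurableD|].
  move=> x Wx; have [Sx|nS] := pselect ((\bigcup_j S j) x); first by left.
  by right; split => //; exact: WOm.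
have split_S C : measurable C ->
    mu (C `&` \bigcup_j S j) = (\sum_(0 <= j <oo) mu (C `&` S j))%E.
  move=> mC; rewrite setI_bigcupr measure_bigcup//=.
  - by apply: eq_eseriesl => j; rewrite in_setT.
  - by move=> j _; exact: measurableI.
  - exact/trivIset_setIl.
have two_k : 0 <= (2 ^+ k)^-1 :> R by rewrite invr_ge0 exprn_ge0.
have two_n : 0 <= 2 ^+ n.+1 :> R by rewrite exprn_ge0.
(* Heaviness bounds the stopped cubes by $2^{n+1}$ times the measure of [Om] in them, in total at
   most half of $|Q|$: this is the factor gained at each induction step. *)
apply: (@le_trans _ _ (((2 ^+ k)^-1 * 2 ^+ n.+1)%:E * mu (Om `&` \bigcup_j S j))%E).
  rewrite !split_S// -nneseriesZl//; apply: lee_nneseries => // j _.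
  apply: (@le_trans _ _ (((2 ^+ k)^-1)%:E * mu (setT `&` S j))%E).
    by apply: (saturated_measure_le l0) (sS j) _ => // m /cubeS[].
  rewrite EFinM -muleA lee_wpmul2l ?lee_fin//.
  by apply: (saturated_measure_le l0) (sS j) _ => // m /cubeS[].
apply: (@le_trans _ _ (((2 ^+ k)^-1 * 2 ^+ n.+1)%:E * mu Om)%E).
  rewrite lee_wpmul2l ?lee_fin ?mulr_ge0//.
  by apply: le_measure; rewrite ?inE//; exact: measurableI.
apply: (@le_trans _ _ (((2 ^+ k)^-1 * 2 ^+ n.+1)%:E * ((2 ^+ n.+2)^-1 * l ^+ n)%:E)%E).
  by rewrite lee_wpmul2l ?lee_fin ?mulr_ge0.
rewrite -EFinM lee_fin le_eqVlt; apply/orP; left; apply/eqP.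
rewrite (exprS _ n.+1) (exprSr _ k).
have : (2 : R) ^+ n.+1 != 0 by rewrite expf_neq0.
have : (2 : R) ^+ k != 0 by rewrite expf_neq0.
by move=> ? ?; field; apply/andP.
Qed.

(** Layer cake over the levels $2\lambda k$, whose sets have proportion at most $2^{-k}$: the
    constant is $2\lambda(1+\sum_{k\ge0}2^{-k})=6\lambda$. *)
Lemma john_stromberg c l : 0 < l ->
  (\int[mu]_(x in hcube c l) (cabs (g x - cc c l))%:E <= (6 * lam * l ^+ n)%:E)%E.
Proof.
move=> l0; set Q := hcube c l.
have mQ : measurable Q := measurable_hcube c l.
have muQ : mu Q = (l ^+ n)%:E by rewrite lebesgue_hcube// ltW.
pose h x := cabs (g x - cc c l).
have mh : measurable_fun Q (fun x => (h x)%:E).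
  apply: measurable_ecabs; apply: cmeasurableW.
  by apply: cmeasurableB => //; exact: cmeasurable_cst.
pose F k x : \bar R := (2 * lam * \1_(dev c l (2 * lam * k%:R)) x)%:E.
have F0 k x : (0 <= F k x)%E by rewrite lee_fin !mulr_ge0// ltW.
have mF k : measurable_fun Q (F k).
  by apply/measurable_EFinP/measurable_funM => //; exact: measurable_indic.
apply: (@le_trans _ _ (\int[mu]_(x in Q) ((2 * lam)%:E + \sum_(0 <= k <oo) F k x))%E).
  apply: ge0_le_integral => //.
  - by move=> x _; rewrite lee_fin cabs_ge0.
  - apply: emeasurable_funD => //.
    by apply: ge0_emeasurable_sum => // *; exact: F0.
  - move=> x Qx.
    have h0 : 0 <= h x / (2 * lam) by rewrite divr_ge0 ?cabs_ge0// mulr_ge0// ltW.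
    (* The levels $2\lambda k$ with $k<N$ lie strictly below $h(x)<2\lambda(N+1)$; the constant term
       absorbs the last step. *)
    pose N := Num.truncn (h x / (2 * lam)).
    have /andP[N1 N2] := truncn_itv h0.
    apply: (@le_trans _ _ ((2 * lam)%:E + \sum_(0 <= k < N) F k x)%E); last first.
      by rewrite leeD2l//; exact: nneseries_lim_ge.
    rewrite (eq_big_nat _ _ (F2 := fun=> (2 * lam)%:E)); last first.
      move=> k /andP[_ kN]; rewrite /F indicE mem_set ?mulr1//.
      rewrite /dev /= -/(h x); move: N1; rewrite ler_pdivlMr ?mulr_gt0//.
      by apply: lt_le_trans; rewrite mulrC ltr_pM2r ?mulr_gt0// ltr_nat.
    rewrite sumEFin -EFinD lee_fin sumr_const_nat subn0.
    move: N2; rewrite ltr_pdivrMr ?mulr_gt0// -/N -[N.+1%:R]natr1 mulrDl mul1r => /ltW.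
    by rewrite (mulr_natl _ N) addrC.
rewrite ge0_integralD//; last 3 first.
  - by move=> x _; rewrite lee_fin mulr_ge0// ltW.
  - by move=> x _; exact: nneseries_ge0.
  - by apply: ge0_emeasurable_sum => // *; exact: F0.
rewrite integral_cst// [X in (_ * X)%E](_ : _ = (l ^+ n)%:E); last exact: muQ.
rewrite integral_nneseries//.
have Fk k : (\int[mu]_(x in Q) F k x <= ((4 * lam * l ^+ n) / (2 ^ k.+1)%:R)%:E)%E.
  rewrite /F; under eq_integral do rewrite EFinM.
  rewrite ge0_integralZl//; last 2 first.
  - by apply/measurable_EFinP; exact: measurable_indic.
  - by rewrite lee_fin mulr_ge0// ltW.
  rewrite integral_indic// setIC.
  apply: (@le_trans _ _ ((2 * lam)%:E * ((2 ^+ k)^-1 * l ^+ n)%:E)%E).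
    by rewrite lee_wpmul2l ?lee_fin ?mulr_ge0 ?(ltW lam0)//; exact: john_stromberg_decay.
  rewrite -EFinM lee_fin natrX exprS; rewrite le_eqVlt; apply/orP; left; apply/eqP.
  have : (2 : R) ^+ k != 0 by rewrite expf_neq0.
  by move=> ?; field.
apply: (@le_trans _ _ ((2 * lam)%:E * (l ^+ n)%:E + (4 * lam * l ^+ n)%:E)%E).
  rewrite leeD2l//; apply: le_trans (lee_nneseries _ (fun k _ => Fk k)) _.
    by move=> k _ _; apply: integral_ge0.
  by rewrite epsilon_trick0// !mulr_ge0 ?exprn_ge0// ltW.
rewrite -EFinM -EFinD lee_fin; rewrite le_eqVlt; apply/orP; left; apply/eqP; ring.
Qed.

End john_stromberg.

(** * Kernels and local oscillation *)

Section integral_facts.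
Context {R : realType} d (T : measurableType d) (m : {measure set T -> \bar R}).
Implicit Types (A B : set T) (f g : T -> \bar R).

Lemma measure_ae_le A B : measurable A -> measurable B ->
  {ae m, forall x, A x -> B x} -> (m A <= m B)%E.
Proof.
move=> mA mB [N [mN N0 subN]]; rewrite -[leRHS]adde0 -[X in (_ + X)%E]N0.
apply: measure_le_setU2 => // x Ax.
have [Bx|nB] := pselect (B x); first by left.
by right; apply: subN => /= /(_ Ax).
Qed.

Lemma integral_setT_support A f : (forall x, ~ A x -> f x = 0%E) ->
  (\int[m]_x f x = \int[m]_(x in A) f x)%E.
Proof.
move=> f0; rewrite [RHS]integral_mkcond; congr (integral _ _ _).
apply/funext => x; rewrite patchE; case: ifPn => // /negP xA.
by apply: f0 => Ax; apply: xA; rewrite inE.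
Qed.


End integral_facts.

Section euclidean_norm.
Context {R : realType} {n : nat}.
Implicit Types x y c : 'rV[R]_n.
Local Notation mu := (lebesgue_rV n).

Lemma enorm_ge0 x : 0 <= enorm x.
Proof. exact: sqrtr_ge0. Qed.

Lemma normr_coord_le_enorm x i : `|x ord0 i| <= enorm x.
Proof.
rewrite -sqrtr_sqr ler_wsqrtr// (bigD1 i)//= lerDl.
by apply: sumr_ge0 => j _; exact: sqr_ge0.
Qed.

(** The crude factor $n$, in place of $\sqrt n$, is the source of the $n$ in the dilation factor
    $2n$ used for cubes. *)
Lemma enorm_le x (r : R) : 0 <= r -> (forall i, `|x ord0 i| <= r) ->
  enorm x <= n%:R * r.
Proof.
move=> r0 xr; have nr0 : 0 <= n%:R * r by rewrite mulr_ge0.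
rewrite -(ger0_norm nr0) -sqrtr_sqr ler_wsqrtr//.
apply: (@le_trans _ _ (\sum_(i < n) r ^+ 2)).
  apply: ler_sum => i _; rewrite -real_normK ?num_real// lerXn2r ?nnegrE//.
rewrite sumr_const card_ord -(mulr_natl (r ^+ 2)) exprMn ler_wpM2r ?sqr_ge0//.
by rewrite expr2 -natrM ler_nat; case: (n) => // p; rewrite leq_pmulr.
Qed.

Lemma measurable_enormB x : measurable_fun setT (fun y => enorm (x - y)).
Proof.
apply: (measurableT_comp (continuous_measurable_fun (@sqrt_continuous R))).
apply: measurable_sum => i; apply: measurable_funX.
rewrite (_ : (fun _ => _) = (fun y => x ord0 i - rV_coord i y)).
  by apply: measurable_funB => //; exact: measurable_rV_coord.
by apply/funext => y; rewrite !mxE.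
Qed.

Lemma measurable_annulus x (a b : R) :
  measurable [set y | a <= enorm (x - y) <= b].
Proof.
rewrite (_ : mkset _ = (fun y => enorm (x - y)) @^-1` `[a, b]).
  by rewrite -[X in measurable X]setTI; exact: measurable_enormB.
by apply/seteqP; split => y /=; rewrite in_itv.
Qed.

Lemma measurable_outside x (a : R) : measurable [set y | enorm (x - y) >= a].
Proof.
rewrite (_ : mkset _ = (fun y => enorm (x - y)) @^-1` `[a, +oo[).
  by rewrite -[X in measurable X]setTI; exact: measurable_enormB.
by apply/seteqP; split => y /=; rewrite in_itv /= andbT.
Qed.

Lemma measurable_diagonal :
  measurable [set p : 'rV[R]_n * 'rV[R]_n | p.1 = p.2].
Proof.
rewrite (_ : mkset _ = \bigcap_(i in [set: 'I_n])
   ((fun p => rV_coord i p.1 - rV_coord i p.2) @^-1` [set 0])); last first.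
  apply/seteqP; split => -[x y] /=.
    by move=> -> i _ /=; rewrite subrr.
  by move=> h; apply/rowP => i; apply/eqP; rewrite -subr_eq0; apply/eqP/h.
apply: fin_bigcap_measurable; first exact: finite_finset.
move=> i _; rewrite -[X in measurable X]setTI.
have mf : measurable_fun setT (fun p : 'rV[R]_n * 'rV[R]_n =>
    rV_coord i p.1 - rV_coord i p.2).
  by apply: measurable_funB;
    exact: (measurableT_comp (measurable_rV_coord i)).
by apply: mf => //; exact: measurable_set1.
Qed.

End euclidean_norm.

(** * Bounded functions supported in a cube *)

Section bounded_functions.
Context {R : realType} {n : nat}.
Local Notation mu := (lebesgue_rV n).
Implicit Types (f g : 'rV[R]_n -> R[i]) (c : 'rV[R]_n) (l M : R).

(** The bound holds almost everywhere because it comes from an $L^\infty$ norm; the vanishing is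
    pointwise because [csupp], the closure of the set where [f] is nonzero, depends on every value
    of [f]. *)
Definition bounded_in c l M f :=
  [/\ cmeasurable setT f, {ae mu, forall x, cabs (f x) <= M} &
      forall x, ~ ccube c l x -> f x = 0].

(** The $L^\infty$ norm branches on whether the whole space has positive measure; this selects the
    essential supremum. *)
Lemma mu_setT_gt0 : (0 < mu [set: 'rV[R]_n])%E.
Proof.
apply: (@lt_le_trans _ _ (mu (ccube 0 1))).
  by rewrite lebesgue_ccube// expr1n lte01.
apply: le_measure; rewrite ?inE//; exact: measurable_ccube.
Qed.

Lemma Lp_norm_yP f M :
  (Lp_norm +oo f <= M%:E)%E <-> {ae mu, forall x, cabs (f x) <= M}.
Proof.
rewrite /Lp_norm unlock mu_setT_gt0.
split => [/ess_supP|h].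
  by apply: filterS => x /=; rewrite lee_fin ger0_norm ?cabs_ge0.
by apply/ess_supP; apply: filterS h => x /=; rewrite lee_fin ger0_norm ?cabs_ge0.
Qed.

End bounded_functions.

Lemma compact_ccube (R : realType) n (c : 'rV[R]_n) l :
  compact (ccube c l).
Proof.
rewrite (_ : ccube c l = [set v | forall i, `[c ord0 i, c ord0 i + l]%classic (v ord0 i)]).
  apply: (@rV_compact _ _ (fun i => `[c ord0 i, c ord0 i + l]%classic)) => i.
  exact: segment_compact.
by apply/seteqP; split => x h i; have := h i; rewrite /= in_itv.
Qed.

Lemma closed_ccube (R : realType) n (c : 'rV[R]_n) l :
  closed (ccube c l).
Proof.
apply: compact_closed; last exact: compact_ccube.
exact: norm_hausdorff.
Qed.

Section bounded_functions2.
Context {R : realType} {n : nat}.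
Local Notation mu := (lebesgue_rV n).
Implicit Types (f g : 'rV[R]_n -> R[i]) (c : 'rV[R]_n) (l M : R).

Lemma csupp_ccube f c l : (forall x, ~ ccube c l x -> f x = 0) ->
  csupp f `<=` ccube c l.
Proof.
move=> f0; rewrite [X in _ `<=` X](closure_id _).1; last exact: closed_ccube.
by apply: closure_subset => x /=; apply: contra_neqP => nc; exact: f0.
Qed.

Lemma bounded_in_csupp c l M f : bounded_in c l M f -> bounded_csupp f.
Proof.
move=> [mf fM f0]; split => //.
  by apply: (@le_lt_trans _ _ M%:E); [exact/Lp_norm_yP|exact: ltry].
apply: (@subclosed_compact _ _ (ccube c l)).
- exact: closed_closure.
- exact: compact_ccube.
- exact: csupp_ccube.
Qed.

Lemma notin_csupp f (x : 'rV[R]_n) (r : R) : 0 < r ->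
  (forall y : 'rV[R]_n, (forall i, `|y ord0 i - x ord0 i| < r) -> f y = 0) -> ~ csupp f x.
Proof.
move=> r0 h /(_ _ (nbhsx_ballx x r r0))[y [/= fy xy]].
move: fy; rewrite h ?eqxx// => i; rewrite distrC.
by case: xy => _; apply.
Qed.

End bounded_functions2.

Section restriction.
Context {R : realType} {n : nat}.
Local Notation mu := (lebesgue_rV n).
Implicit Types (f g : 'rV[R]_n -> R[i]) (c : 'rV[R]_n) (l M : R).

Definition restr (A : set 'rV[R]_n) f : 'rV[R]_n -> R[i] :=
  fun y => (\1_A y : R)%:C%C * f y.

Lemma restr_in A f y : A y -> restr A f y = f y.
Proof. by move=> Ay; rewrite /restr indicE mem_set// mul1r. Qed.

Lemma restr_notin A f y : ~ A y -> restr A f y = 0.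
Proof. by move=> Ay; rewrite /restr indicE memNset// mul0r. Qed.

(** The factor [1] gives the decomposition the shape $af+g$ in which the linearity of [T] is
    available. *)
Lemma restrDC A f : f = (fun y => 1 * restr A f y + restr (~` A) f y).
Proof.
apply/funext => y; rewrite mul1r; have [Ay|nAy] := pselect (A y).
  by rewrite restr_in// restr_notin ?addr0//; exact.
by rewrite restr_notin// restr_in ?add0r.
Qed.

Lemma cabs_restr_le A f y : cabs (restr A f y) <= cabs (f y).
Proof.
have [Ay|nAy] := pselect (A y); first by rewrite restr_in.
by rewrite restr_notin// cabs0 cabs_ge0.
Qed.

Lemma bounded_in_restr A c l M f : measurable A ->
  bounded_in c l M f -> bounded_in c l M (restr A f).
Proof.
move=> mA [mf fM f0]; split.
- by apply: cmeasurableM => //; exact: cmeasurable_indic.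
- by apply: filterS fM => x; apply: le_trans; exact: cabs_restr_le.
- by move=> x /f0 fx0; rewrite /restr fx0 mulr0.
Qed.

Lemma bounded_inD c l M M' f g : bounded_in c l M f -> bounded_in c l M' g ->
  bounded_in c l (M + M') (fun y => f y + g y).
Proof.
move=> [mf fM f0] [mg gM g0]; split.
- exact: cmeasurableD.
- apply: filterS2 fM gM => x fx gx.
  by apply: le_trans (ler_cabsD _ _) _; exact: lerD.
- by move=> x nx; rewrite f0// g0// addr0.
Qed.

Lemma bounded_inM c l M f (z : R[i]) : bounded_in c l M f ->
  bounded_in c l (cabs z * M) (fun y => z * f y).
Proof.
move=> [mf fM f0]; split.
- by apply: cmeasurableM => //; exact: cmeasurable_cst.
- by apply: filterS fM => x fx; rewrite cabsM ler_wpM2l// cabs_ge0.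
- by move=> x /f0 ->; rewrite mulr0.
Qed.

Lemma bounded_in_le c l c' l' M f : ccube c l `<=` ccube c' l' ->
  bounded_in c l M f -> bounded_in c' l' M f.
Proof.
by move=> sub [mf fM f0]; split => // x nx; apply: f0 => /sub.
Qed.

Lemma bounded_in_indic (A : set 'rV[R]_n) c l : measurable A ->
  A `<=` ccube c l -> bounded_in c l 1 (fun y => (\1_A y : R)%:C%C).
Proof.
move=> mA Asub; split; first exact: cmeasurable_indic.
- by apply/nearW => x; rewrite cabs_real indicE; case: (_ \in _); rewrite ?normr1 ?normr0.
- by move=> x nx; rewrite indicE memNset// => /Asub.
Qed.

Lemma integral_cabs_le c l M f : 0 <= l -> 0 <= M -> bounded_in c l M f ->
  (\int[mu]_x (cabs (f x))%:E <= (M * l ^+ n)%:E)%E.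
Proof.
move=> l0 M0 [mf fM f0].
rewrite (integral_setT_support _ (A := ccube c l)); last first.
  by move=> x /f0 ->; rewrite cabs0.
have mc := measurable_ccube c l.
apply: (@le_trans _ _ (\int[mu]_(x in ccube c l) (cst M%:E x))%E).
  apply: ae_ge0_le_integral => //.
  - by move=> x _; rewrite lee_fin cabs_ge0.
  - by apply: measurable_ecabs; exact: cmeasurableW.
  - by apply: filterS fM => x fx _; rewrite lee_fin.
rewrite integral_cst// [X in (_ * X)%E](_ : _ = (l ^+ n)%:E); last exact: lebesgue_ccube.
by rewrite -EFinM.
Qed.

Lemma bounded_in_integrable c l M f : 0 <= l -> 0 <= M -> bounded_in c l M f ->
  cintegrable mu setT f.
Proof.
move=> l0 M0 fM; have := integral_cabs_le l0 M0 fM; case: fM => mf _ _ h.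
by apply: cintegrableP => //; apply: le_lt_trans h _; rewrite ltry.
Qed.

End restriction.

(** * Integrals of the kernel against bounded functions *)

Section kernel.
Context {R : realType} {n : nat}.
Local Notation mu := (lebesgue_rV n).
Implicit Types (x y c : 'rV[R]_n) (l M r : R).
Variables (K : 'rV[R]_n -> 'rV[R]_n -> R[i]) (CS : R).
Hypothesis mK : cmeasurable setT (fun p => K p.1 p.2).
Hypothesis sizeK : forall x r, 0 < r ->
  (\int[mu]_(y in [set y | (r <= enorm (x - y) <= 2 * r)%R])
     (cabs (K x y))%:E <= CS%:E)%E.
Lemma cmeasurable_kernel_l x : cmeasurable setT (K x).
Proof. exact: (cmeasurable_comp (pair1_measurable x) mK). Qed.

Lemma cmeasurable_kernel_r y : cmeasurable setT (K ^~ y).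
Proof. exact: (cmeasurable_comp (pair2_measurable y) mK). Qed.

Let annulus x r (J : nat) : set 'rV[R]_n :=
  [set y | r <= enorm (x - y) <= 2 ^+ J.+1 * r].

(** One application of the size condition for each of the $J+1$ shells $2^jr\le|x-y|\le2^{j+1}r$;
    the previous annulus is removed from each new shell to make the union disjoint. *)
Lemma size_dyadic x r J : 0 < r ->
  (\int[mu]_(y in annulus x r J) (cabs (K x y))%:E <= (J.+1%:R * CS)%:E)%E.
Proof.
move=> r0; elim: J => [|J IH].
  by rewrite mul1r; have := sizeK x r0; rewrite /annulus expr1.
pose r' := 2 ^+ J.+1 * r.
have r'0 : 0 < r' by rewrite mulr_gt0// exprn_gt0.
pose B := [set y : 'rV[R]_n | r' <= enorm (x - y) <= 2 * r'].
have mB : measurable B by exact: measurable_annulus.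
have mA : measurable (annulus x r J) by exact: measurable_annulus.
have mA1 : measurable (annulus x r J.+1) by exact: measurable_annulus.
have mk : measurable_fun setT (fun y => (cabs (K x y))%:E).
  by apply: measurable_ecabs; exact: cmeasurable_kernel_l.
have k0 y : (0 <= (cabs (K x y))%:E)%E by rewrite lee_fin cabs_ge0.
have sub : annulus x r J.+1 `<=` annulus x r J `|` (B `\` annulus x r J).
  move=> y /andP[y1 y2]; have [Ay|nAy] := pselect (annulus x r J y); first by left.
  right; split => //; apply/andP; split; last first.
    by move: y2; rewrite /r' mulrA -exprS.
  by rewrite leNgt; apply/negP => lt; apply: nAy; rewrite /annulus /= y1 ltW.
apply: le_trans (ge0_subset_integral _ _ _ _ _ sub) _ => //.
- by apply: measurableU => //; exact: measurableD.
- exact: measurable_funTS.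
rewrite ge0_integral_setU//; last 3 first.
- exact: measurableD.
- exact: measurable_funTS.
- by apply/disj_setPS => y [Ay []].
rewrite -[J.+2%:R]natr1 mulrDl mul1r EFinD leeD//.
apply: le_trans (sizeK x r'0); apply: ge0_subset_integral => //.
- exact: measurableD.
- exact: measurable_funTS.
Qed.

Lemma integral_kernel_le x r J M f : 0 < r -> 0 <= M -> cmeasurable setT f ->
  {ae mu, forall y, cabs (f y) <= M} ->
  (forall y, f y != 0 -> annulus x r J y) ->
  (\int[mu]_y (cabs (K x y * f y))%:E <= (M * (J.+1%:R * CS))%:E)%E.
Proof.
move=> r0 M0 mf fM fA.
have mA : measurable (annulus x r J) by exact: measurable_annulus.
have mk : cmeasurable setT (K x) by exact: cmeasurable_kernel_l.
rewrite (integral_setT_support _ (A := annulus x r J)); last first.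
  move=> y nA; have -> : f y = 0 by apply: contra_not_eq nA => /fA.
  by rewrite mulr0 cabs0.
apply: (@le_trans _ _ (\int[mu]_(y in annulus x r J) (M%:E * (cabs (K x y))%:E))%E).
  apply: ae_ge0_le_integral => //.
  - by move=> y _; rewrite lee_fin cabs_ge0.
  - by apply: measurable_ecabs; apply: cmeasurableW; exact: cmeasurableM.
  - by move=> y _; rewrite mule_ge0// lee_fin// cabs_ge0.
  - apply/measurable_EFinP; apply: measurable_funM => //.
    by apply: measurable_cabs; exact: cmeasurableW.
  - apply: filterS fM => y fy _.
    by rewrite -EFinM lee_fin cabsM mulrC ler_wpM2r// cabs_ge0.
rewrite ge0_integralZl//; last 2 first.
- by apply: measurable_ecabs; exact: cmeasurableW.
- by move=> y _; rewrite lee_fin cabs_ge0.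
by rewrite EFinM lee_wpmul2l ?lee_fin//; exact: size_dyadic.
Qed.

(** Kernel integrals can be subtracted only once each is known to converge. The support meets
    finitely many dyadic shells around [x]; their number depends on [x], which is harmless since
    only finiteness is wanted. *)
Lemma kernel_integrable x r c l M f : 0 < r -> 0 <= M -> 0 <= l ->
  bounded_in c l M f -> (forall y, f y != 0 -> r <= enorm (x - y)) ->
  cintegrable mu setT (fun y => K x y * f y).
Proof.
move=> r0 M0 l0 [mf fM f0] fr.
apply: cintegrableP => //.
  by apply: cmeasurableM => //; exact: cmeasurable_kernel_l.
pose B := n%:R * (enorm (x - c) + l).
have B0 : 0 <= B / r by rewrite divr_ge0 ?(ltW r0)// mulr_ge0// addr_ge0// enorm_ge0.
pose J := Num.bound (B / r).
apply: (@le_lt_trans _ _ (M * (J.+1%:R * CS))%:E); last exact: ltry.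
apply: (integral_kernel_le r0) => // y fy.
rewrite /annulus /= fr//=.
have yc : ccube c l y by apply: contrapT => /f0/eqP; exact/negP.
apply: (@le_trans _ _ B).
  apply: enorm_le => [|i]; first by rewrite addr_ge0// enorm_ge0.
  have /andP[y1 y2] := yc i.
  have : `|(x - c) ord0 i| <= enorm (x - c) by exact: normr_coord_le_enorm.
  rewrite !mxE !ler_norml => /andP[h1 h2]; apply/andP; split; lra.
rewrite -ler_pdivrMr//; apply: le_trans (ltW (archi_boundP B0)) _.
by rewrite -natrX ler_nat ltnW// (leq_trans (ltn_expl _ (isT : 1 < 2)%N))// leq_exp2l.
Qed.

End kernel.

(** * Local oscillation, and the estimates near and far from the support *)

Section operator.
Context {R : realType} {n : nat}.
Local Notation mu := (lebesgue_rV n).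
Implicit Types (f g b : 'rV[R]_n -> R[i]) (x y c : 'rV[R]_n) (l M r W : R).

Local Notation D := (2 * n%:R : R)%R.

(* Cubes are balls of the sup norm; the factor [2 n] makes up for the Euclidean
   norm and for the factor [2] in the Hoermander condition. *)
Definition qstar c l : set 'rV[R]_n :=
  ccube (c - const_mx (D * l)) (2 * (D * l)).

Lemma qstarP c l y :
  qstar c l y <-> forall i, `|y ord0 i - c ord0 i| <= D * l.
Proof.
split => h i; have := h i.
  by rewrite !mxE ler_norml => /andP[h1 h2]; apply/andP; split; lra.
by rewrite !mxE ler_norml => /andP[h1 h2]; apply/andP; split; lra.
Qed.

Lemma notin_qstar c l y : ~ qstar c l y ->
  exists i, D * l < `|y ord0 i - c ord0 i|.
Proof.
move=> nq; apply: contrapT => no; apply: nq; apply/qstarP => i.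
by rewrite leNgt; apply/negP => lt; apply: no; exists i.
Qed.

Lemma measurable_qstar c l : measurable (qstar c l).
Proof. exact: measurable_ccube. Qed.

Variables (K : 'rV[R]_n -> 'rV[R]_n -> R[i]) (CS CH : R)
  (T : ('rV[R]_n -> R[i]) -> 'rV[R]_n -> R[i]).
Hypothesis n0 : (0 < n)%N.
Hypothesis mK : cmeasurable setT (fun p => K p.1 p.2).
Hypothesis CS0 : 0 <= CS.
Hypothesis CH0 : 0 <= CH.
Hypothesis sizeK : forall x r, 0 < r ->
  (\int[mu]_(y in [set y | (r <= enorm (x - y) <= 2 * r)%R])
     (cabs (K x y))%:E <= CS%:E)%E.
Hypothesis hormanderK : forall x x',
  (\int[mu]_(y in [set y | (2 * enorm (x - x') <= enorm (x - y))%R])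
     (cabs (K x y - K x' y))%:E <= CH%:E)%E.
Hypothesis hormander_trK : forall x x',
  (\int[mu]_(y in [set y | (2 * enorm (x - x') <= enorm (x - y))%R])
     (cabs (K y x - K y x'))%:E <= CH%:E)%E.
Hypothesis mT : forall f, bounded_csupp f -> cmeasurable setT (T f).
Hypothesis linT : forall (a : R[i]) f g, bounded_csupp f -> bounded_csupp g ->
  {ae mu, forall x, T (fun z => a * f z + g z) x = a * T f x + T g x}.
Hypothesis kerT : forall f, bounded_csupp f ->
  {ae mu, forall x, ~ csupp f x ->
     T f x = cintegral mu setT (fun y => K x y * f y)}.

Let D2 : 2 <= D.
Proof. by rewrite ler_peMr// ler1n. Qed.

(** For [x] in the cube $|c-x|\le nl$, whereas $|c-y|\ge2nl$ off [qstar c l], so the Hoermander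
    condition applies to the pair $(c,x)$. The factor $2$ is that of [cabs_cintegral_le]. *)
Lemma kernel_osc c l x f c' l' : 0 < l -> 0 <= l' -> hcube c l x ->
  bounded_in c' l' 1 f ->
  cabs (cintegral mu setT (fun y => K x y * restr (~` qstar c l) f y) -
        cintegral mu setT (fun y => K c y * restr (~` qstar c l) f y)) <= 2 * CH.
Proof.
move=> l0 l'0 xQ bf.
have D2' := D2.
pose g := restr (~` qstar c l) f.
have bg : bounded_in c' l' 1 g.
  by apply: bounded_in_restr => //; apply: measurableC; exact: measurable_qstar.
have gq y : g y != 0 -> exists i, D * l < `|y ord0 i - c ord0 i|.
  move=> gy; apply: notin_qstar => qy; move: gy.
  by rewrite /g restr_notin ?eqxx//; exact.
have xc i : `|c ord0 i - x ord0 i| <= l.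
  by have /andP[h1 h2] := xQ i; rewrite ler_norml; apply/andP; split; lra.
have Dl : 2 * l <= D * l by rewrite ler_wpM2r// ltW.
have gc y : g y != 0 -> D * l <= enorm (c - y).
  move=> /gq[i lt]; apply: le_trans (normr_coord_le_enorm _ i).
  by rewrite !mxE distrC ltW.
have gx y : g y != 0 -> l <= enorm (x - y).
  move=> /gq[i lt]; apply: le_trans (normr_coord_le_enorm _ i).
  rewrite !mxE; have := ler_distD (x ord0 i) (y ord0 i) (c ord0 i).
  have := xc i; rewrite (distrC (x ord0 i) (c ord0 i)) (distrC (x ord0 i) (y ord0 i)).
  by lra.
have ix := kernel_integrable mK sizeK l0 ler01 l'0 bg gx.
have ic : cintegrable mu setT (fun y => K c y * g y).
  apply: (kernel_integrable mK sizeK l0 ler01 l'0 bg) => y gy.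
  by apply: le_trans (gc _ gy); lra.
rewrite -cintegralB//.
have [mg g1 _] := bg.
have mKc := cmeasurable_kernel_l mK c.
have mKx := cmeasurable_kernel_l mK x.
have md : cmeasurable setT (fun y => K x y * g y - K c y * g y).
  by apply: cmeasurableB; exact: cmeasurableM.
rewrite -lee_fin; apply: le_trans (cabs_cintegral_le _ _ md) _ => //.
rewrite EFinM lee_wpmul2l ?lee_fin//.
pose A : set 'rV[R]_n := [set y | 2 * enorm (c - x) <= enorm (c - y)].
have mA : measurable A by exact: measurable_outside.
apply: le_trans (hormanderK c x).
rewrite (integral_setT_support _ (A := A)).
  apply: ae_ge0_le_integral => //.
  - by move=> y _; rewrite lee_fin cabs_ge0.
  - by apply: measurable_ecabs; exact: cmeasurableW.
  - by move=> y _; rewrite lee_fin cabs_ge0.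
  - by apply: measurable_ecabs; apply: cmeasurableW; exact: cmeasurableB.
  - apply: filterS g1 => y gy _.
    rewrite lee_fin -mulrBl cabsM -cabsN opprB -[leRHS]mulr1.
    by rewrite ler_wpM2l// cabs_ge0.
move=> y nA; have [->|/gc gy] := eqVneq (g y) 0.
  by rewrite !mulr0 subrr cabs0.
exfalso; apply: nA; rewrite /A /=; apply: le_trans gy.
rewrite -mulrA ler_wpM2l//; apply: enorm_le; first exact: ltW.
by move=> i; rewrite !mxE; exact: xc.
Qed.

(** One factor $2$ comes from [cabs_cintegral_le], the other from $|b|\le2$. In each coordinate the
    support of [b] is at distance between $Dl$ and $9Dl$ from a point of the cube, so at Euclidean
    distance at most $9nDl\le2^{9n+1}Dl$: this takes $9n+1$ dyadic shells. *)
Definition escape_const := 2 * (2 * ((9 * n).+1%:R * CS)).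

Lemma T_escape c l b : 0 < l ->
  bounded_in (c - const_mx (D * l)) (10 * (D * l)) 2 b ->
  (forall y, b y != 0 -> forall i, 2 * (D * l) <= y ord0 i - c ord0 i) ->
  {ae mu, forall x, hcube c l x -> cabs (T b x) <= escape_const}.
Proof.
move=> l0 bb bsupp; have D2' := D2.
have Dl : 2 * l <= D * l by rewrite ler_wpM2r// ltW.
have Dl0 : 0 < D * l by lra.
have bc := bounded_in_csupp bb; have [mb b2 b0] := bb.
apply: filterS (kerT bc) => x Tx xQ; rewrite Tx; last first.
  apply: (notin_csupp Dl0) => y xy; apply/eqP; apply: contrapT => /negP by0.
  have := bsupp y by0 (Ordinal n0); have := xy (Ordinal n0).
  have /andP[_] := xQ (Ordinal n0).
  by rewrite ltr_norml => h1 /andP[h2 h3] h4; lra.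
have mKx := cmeasurable_kernel_l mK x.
rewrite -lee_fin; apply: le_trans (cabs_cintegral_le _ _ _) _ => //.
  exact: cmeasurableM.
rewrite EFinM lee_wpmul2l ?lee_fin//.
apply: (integral_kernel_le mK sizeK Dl0) => // y by0 /=.
have yb i : D * l <= y ord0 i - x ord0 i <= 9 * (D * l).
  have := bsupp y by0 i; have /andP[x1 x2] := xQ i.
  have : ccube (c - const_mx (D * l)) (10 * (D * l)) y.
    by apply: contrapT => /b0/eqP; exact/negP.
  by move=> /(_ i); rewrite !mxE => /andP[y1 y2] y3; apply/andP; split; lra.
apply/andP; split.
  apply: le_trans (normr_coord_le_enorm _ (Ordinal n0)).
  rewrite !mxE distrC; have /andP[h _] := yb (Ordinal n0).
  by apply: le_trans h _; exact: ler_norm.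
apply: (@le_trans _ _ (n%:R * (9 * (D * l)))).
  apply: enorm_le => [|i]; first lra.
  rewrite !mxE distrC ger0_norm; have /andP[h1 h2] := yb i; lra.
rewrite mulrA ler_wpM2r ?(ltW Dl0)// -natrM -natrX ler_nat mulnC.
by apply: ltnW; apply: leq_trans (ltn_expl _ (isT : 1 < 2)%N) _; rewrite leq_exp2l.
Qed.

(* [b] is the correction that turns the part of [f] in [qstar c l] into a
   multiple of an atom. *)
Definition localizable W f := forall c l, 0 < l -> exists b,
  [/\ bounded_in (c - const_mx (D * l)) (10 * (D * l)) 2 b,
      forall y, b y != 0 -> forall i, 2 * (D * l) <= y ord0 i - c ord0 i &
      forall lam, 0 < lam ->
        (mu [set x | (cabs (T (fun z => 1 * restr (qstar c l) f z + b z)%R x)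
                       > lam)%R] <= (W * l ^+ n / lam)%:E)%E].

Definition osc_center f c l : R[i] :=
  cintegral mu setT (fun y => K c y * restr (~` qstar c l) f y).

Definition osc_const := 2 * CH + escape_const.

(** Almost everywhere on the cube, $Tf-c_Q=T(f_1+b)+(Tf_2-c_Q)-Tb$, where the last two terms have
    modulus at most $2C_H$ and [escape_const]. A deviation above $\lambda$ plus these constants must
    come from $T(f_1+b)$. *)
Lemma local_osc W f c' l' c l lam : 0 <= l' -> bounded_in c' l' 1 f ->
  localizable W f -> 0 < l -> 0 < lam ->
  (mu (hcube c l `&` [set x | (cabs (T f x - osc_center f c l) > lam + osc_const)%R])
    <= (W * l ^+ n / lam)%:E)%E.
Proof.
move=> l'0 bf /(_ c l) loc l0 lam0; have D2' := D2.
have Dl : 2 * l <= D * l by rewrite ler_wpM2r// ltW.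
have Dl0 : 0 < D * l by lra.
have [b [bb bsupp weak]] := loc l0.
apply: le_trans (weak _ lam0).
set p := (fun z => _) in weak *.
have mq := measurable_qstar c l.
have bf1 : bounded_in c' l' 1 (restr (qstar c l) f) by exact: bounded_in_restr.
have bf2 : bounded_in c' l' 1 (restr (~` qstar c l) f).
  by apply: bounded_in_restr => //; exact: measurableC.
have bf1' : bounded_in (c - const_mx (D * l)) (10 * (D * l)) 1 (restr (qstar c l) f).
  have [? ? _] := bf1; split => // y ny; apply: restr_notin => qy; apply: ny => i.
  by have := qy i; rewrite !mxE => /andP[h1 h2]; apply/andP; split; lra.
have cp : bounded_csupp p.
  have -> : p = (fun z => restr (qstar c l) f z + b z).
    by apply/funext => z; rewrite /p mul1r.
  exact: bounded_in_csupp (bounded_inD bf1' bb).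
have lin1 := linT 1 (bounded_in_csupp bf1) (bounded_in_csupp bf2).
rewrite -restrDC in lin1.
have lin2 := linT 1 (bounded_in_csupp bf1) (bounded_in_csupp bb).
have ker2 := kerT (bounded_in_csupp bf2).
have esc := T_escape l0 bb bsupp.
have cf := bounded_in_csupp bf.
apply: measure_ae_le.
- apply: measurableI; first exact: measurable_hcube.
  apply: (@measurable_cabs_gt _ _ _ (fun x => T f x - osc_center f c l)).
  by apply: cmeasurableB; [exact: mT|exact: cmeasurable_cst].
- by apply: measurable_cabs_gt; exact: mT.
- apply: filterS2 (filterI lin1 lin2) (filterI ker2 esc).
  move=> x [l1 l2] [k2 ex] [xQ].
  have /k2 {}k2 : ~ csupp (restr (~` qstar c l) f) x.
    apply: (notin_csupp l0) => y xy; apply: restr_notin; apply; apply/qstarP => i.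
    have /andP[x1 x2] := xQ i; have := xy i.
    by rewrite ltr_norml ler_norml => /andP[h1 h2]; apply/andP; split; lra.
  have {}ex := ex xQ.
  have := kernel_osc l0 l'0 xQ bf; rewrite -k2 -/(osc_center f c l) => osc.
  rewrite /= => big.
  have -> : T p x = (T f x - osc_center f c l) -
      (T (restr (~` qstar c l) f) x - osc_center f c l) + T b x.
    by rewrite l2 l1; ring.
  move: big osc; set u := T f x - _; set v := T _ x - _ => big osc.
  have -> : u = (u - v + T b x) + (v - T b x) by ring.
  rewrite -/u in big.
  have h1 : cabs u <= cabs (u - v + T b x) + cabs (v - T b x).
    by apply: le_trans (ler_cabsD _ _); rewrite (_ : _ + _ = u)//; ring.
  have h2 := ler_cabsB v (T b x).
  rewrite (_ : _ - v + _ = u - v + T b x); last ring.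
  by move: big; rewrite /osc_const; lra.
Qed.

(** The level $W2^{n+2}$ turns the weak estimate $Wl^n/\lambda$ into the proportion $2^{-(n+2)}$
    that [john_stromberg] requires. *)
Lemma T_near W f c l : 0 < W -> 0 < l -> bounded_in c l 1 f -> localizable W f ->
  (\int[mu]_(x in hcube (c - const_mx (D * l)%R) (2 * (D * l))%R) (cabs (T f x))%:E
   <= (6 * (W * 2 ^+ n.+2 + osc_const) * (2 * (D * l)) ^+ n)%:E)%E.
Proof.
move=> W0 l0 bf loc; have D2' := D2.
have Dl : 2 * l <= D * l by rewrite ler_wpM2r// ltW.
have Q0 : 0 < 2 * (D * l) by lra.
have osc0 : 0 <= osc_const by rewrite /osc_const /escape_const addr_ge0 ?mulr_ge0.
have W20 : 0 < W * 2 ^+ n.+2 by rewrite mulr_gt0// exprn_gt0.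
have lam0 : 0 < W * 2 ^+ n.+2 + osc_const by lra.
have := @john_stromberg _ _ (T f) (osc_center f) _ (mT (bounded_in_csupp bf)) lam0.
move=> /(_ _ (c - const_mx (D * l)) _ Q0) h.
set c1 := c - const_mx (D * l) in h *; set l1 := 2 * (D * l) in h Q0 *.
(* The dilate of the large cube contains the support of [f], so the truncation outside it is
   zero. *)
have z0 : osc_center f c1 l1 = 0.
  rewrite /osc_center (@eq_cintegral _ _ _ _ _ _ (fun=> 0)).
    by rewrite /cintegral /Rintegral integral0.
  move=> y _; have [yc|nyc] := pselect (ccube c l y).
    rewrite restr_notin ?mulr0//; apply; apply/qstarP => i.
    have := yc i; rewrite !mxE /l1 ler_norml => /andP[h1 h2].
    have : 2 * (2 * (D * l)) <= D * (2 * (D * l)) by rewrite ler_wpM2r// ltW.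
    by move=> h3; apply/andP; split; lra.
  by have [_ _ f0] := bf; rewrite /restr f0// !mulr0.
rewrite z0 in h; under eq_integral do rewrite -[T f _]subr0; apply: h.
move=> c2 l2 l20. apply: le_trans (local_osc c2 (ltW l0) bf loc l20 W20) _.
rewrite lee_fin le_eqVlt; apply/orP; left; apply/eqP.
have : (2 : R) ^+ n.+2 != 0 by rewrite expf_neq0.
have Wn0 : W != 0 by rewrite gt_eqF.
by move: (2 ^+ n.+2) => e e0; field; apply/andP.
Qed.

(** Since [f] has mean zero, $Tf(x)=\int(K(x,y)-K(x,c))f(y)\,dy$ for almost every [x] outside the
    large cube. Tonelli puts the integral in [x] inside, where $|c-x|\ge2nl\ge2|c-y|$ and the
    Hoermander condition in the other variable applies. *)
Lemma T_far f c l : 0 < l -> bounded_in c l 1 f -> cintegral mu setT f = 0 ->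
  (\int[mu]_(x in ~` hcube (c - const_mx (D * l)%R) (2 * (D * l))%R)
     (cabs (T f x))%:E <= (2 * CH * l ^+ n)%:E)%E.
Proof.
move=> l0 bf f_0; have D2' := D2.
have Dl : 2 * l <= D * l by rewrite ler_wpM2r// ltW.
have Dl0 : 0 < D * l by lra.
set Q := hcube _ _.
have mQc : measurable (~` Q) by apply: measurableC; exact: measurable_hcube.
have [mf f1 f0] := bf; have cf := bounded_in_csupp bf.
have if_ := bounded_in_integrable (ltW l0) ler01 bf.
have xQc x : (~` Q) x -> exists i, D * l <= `|c ord0 i - x ord0 i|.
  move=> nQ; apply: contrapT => no; apply: nQ => i.
  have : ~ (D * l <= `|c ord0 i - x ord0 i|) by move=> le; apply: no; exists i.
  move/negP; rewrite -ltNge ltr_norml !mxE => /andP[h1 h2].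
  by apply/andP; split; lra.
(* The restriction to the complement is put into the integrand, so that Tonelli is applied on the
   whole product space. *)
pose G x y : \bar R := ((\1_(~` Q) x) * cabs ((K x y - K x c) * f y))%:E.
have mG : measurable_fun setT (fun p : 'rV[R]_n * 'rV[R]_n => G p.1 p.2).
  apply/measurable_EFinP; apply: measurable_funM.
    have mI : measurable_fun setT (\1_(~` Q) : 'rV[R]_n -> R).
      exact: measurable_indic.
    exact: (measurableT_comp mI measurable_fst).
  apply: measurable_cabs; apply: cmeasurableM.
    apply: cmeasurableB => //.
    exact: (cmeasurable_comp measurable_fst (cmeasurable_kernel_r mK c)).
  exact: (cmeasurable_comp measurable_snd mf).
have G0 p : (0 <= G p.1 p.2)%E by rewrite lee_fin mulr_ge0// cabs_ge0.
have mGx x : measurable_fun setT (G x).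
  exact: (measurableT_comp mG (pair1_measurable x)).
have mGy y : measurable_fun setT (G ^~ y).
  exact: (measurableT_comp mG (pair2_measurable y)).
have mIx : measurable_fun setT (fun x => \int[mu]_y G x y)%E.
  exact: (measurable_fun_fubini_tonelli_F _ mG).
have mIy : measurable_fun setT (fun y => \int[mu]_x G x y)%E.
  exact: (measurable_fun_fubini_tonelli_G _ mG).
apply: (@le_trans _ _ (\int[mu]_(x in ~` Q) (2%:E * \int[mu]_y G x y))%E).
  apply: ae_ge0_le_integral => //.
  - by move=> x _; rewrite lee_fin cabs_ge0.
  - by apply: measurable_ecabs; apply: cmeasurableW; exact: mT.
  - move=> x _; rewrite mule_ge0// ?lee_fin//; apply: integral_ge0 => y _.
    exact: (G0 (x, y)).
  - by apply: measurable_funeM; exact: measurable_funTS.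
  - apply: filterS (kerT cf) => x Tx Qx.
    have [i xi] := xQc x Qx.
    rewrite Tx; last first.
      apply: (notin_csupp l0) => y xy; apply: f0 => /(_ i) /andP[y1 y2].
      have := xy i; rewrite ltr_norml => /andP[h1 h2].
      by move: xi; rewrite leNgt; move/negP; apply; rewrite ltr_norml; apply/andP; split; lra.
    have fx y : f y != 0 -> l <= enorm (x - y).
      move=> fy; have /(_ i)/andP[y1 y2] : ccube c l y.
        by apply: contrapT => /f0/eqP; exact/negP.
      apply: le_trans (normr_coord_le_enorm _ i); rewrite !mxE.
      have := ler_distD (y ord0 i) (c ord0 i) (x ord0 i).
      rewrite (distrC (y ord0 i) (x ord0 i)).
      have : `|c ord0 i - y ord0 i| <= l by rewrite ler_norml; apply/andP; split; lra.
      by lra.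
    have ix := kernel_integrable mK sizeK l0 ler01 (ltW l0) bf fx.
    have -> : cintegral mu setT (fun y => K x y * f y) =
        cintegral mu setT (fun y => K x y * f y - K x c * f y).
      rewrite cintegralB//; first by rewrite cintegralMl// f_0 mulr0 subr0.
      apply: (bounded_in_integrable (ltW l0) _ (bounded_inM (K x c) bf)).
      by rewrite mulr1 cabs_ge0.
    apply: le_trans (cabs_cintegral_le _ _ _) _ => //.
      apply: cmeasurableB; first by apply: cmeasurableM => //; exact: cmeasurable_kernel_l.
      by apply: cmeasurableM => //; exact: cmeasurable_cst.
    rewrite lee_wpmul2l ?lee_fin// le_eqVlt; apply/orP; left; apply/eqP.
    apply: eq_integral => y _; rewrite /G indicE mem_set// mul1r.
    by rewrite mulrBl.
rewrite ge0_integralZl//; last 2 first.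
- exact: measurable_funTS.
- by move=> x _; apply: integral_ge0 => y _; exact: (G0 (x, y)).
rewrite -mulrA EFinM lee_wpmul2l ?lee_fin//.
apply: (@le_trans _ _ (\int[mu]_x \int[mu]_y G x y)%E).
  apply: ge0_subset_integral => //.
  by move=> x _; apply: integral_ge0 => y _; exact: (G0 (x, y)).
rewrite (fubini_tonelli (fun p => G p.1 p.2))//=.
apply: (@le_trans _ _ (\int[mu]_y (CH%:E * (cabs (f y))%:E))%E).
  apply: ge0_le_integral => //.
  - by move=> y _; apply: integral_ge0 => x _; exact: (G0 (x, y)).
  - by apply: measurable_funeM; exact: measurable_ecabs.
  move=> y _; have [fy|fy] := eqVneq (f y) 0.
    rewrite fy cabs0 mule0 integral0_eq// => x _.
    by rewrite /G fy mulr0 cabs0 mulr0.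
  have yc : ccube c l y by apply: contrapT => /f0/eqP; exact/negP.
  pose A : set 'rV[R]_n := [set x | 2 * enorm (c - y) <= enorm (c - x)].
  have mA : measurable A by exact: measurable_outside.
  have mk : cmeasurable setT (fun x => K x c - K x y).
    by apply: cmeasurableB; exact: cmeasurable_kernel_r.
  rewrite (integral_setT_support _ (A := A)); last first.
    move=> x nA; rewrite /G indicE memNset ?mul0r// => /xQc[i xi]; apply: nA.
    rewrite /A /=; apply: (@le_trans _ _ (D * l)); last first.
      by apply: le_trans xi _; have := normr_coord_le_enorm (c - x) i; rewrite !mxE.
    rewrite -mulrA ler_wpM2l//; apply: enorm_le; first exact: ltW.
    move=> j; have /andP[h1 h2] := yc j.
    by rewrite !mxE ler_norml; apply/andP; split; lra.
  apply: (@le_trans _ _ (\int[mu]_(x in A) ((cabs (K x c - K x y))%:E * (cabs (f y))%:E))%E).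
    apply: ge0_le_integral => //.
    - by move=> x _; exact: (G0 (x, y)).
    - exact: measurable_funTS.
    - apply/measurable_EFinP; apply: measurable_funM => //.
      by apply: measurable_cabs; exact: cmeasurableW.
    - move=> x _; rewrite /G -EFinM lee_fin -cabsM -cabsN -mulNr opprB.
      by rewrite ler_piMl ?cabs_ge0// indicE; case: (_ \in _).
  rewrite ge0_integralZr//; last 3 first.
  - by apply: measurable_ecabs; exact: cmeasurableW.
  - by move=> x _; rewrite lee_fin cabs_ge0.
  - by rewrite lee_fin cabs_ge0.
  by rewrite lee_wpmul2r ?lee_fin ?cabs_ge0//; exact: hormander_trK.
rewrite ge0_integralZl//; last 2 first.
- exact: measurable_ecabs.
- by move=> y _; rewrite lee_fin cabs_ge0.
rewrite EFinM lee_wpmul2l ?lee_fin//.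
by have := integral_cabs_le (ltW l0) ler01 bf; rewrite mul1r.
Qed.

End operator.

(** * Atoms *)

(** The second inequality is the maximality of [N]. Least natural exponents are available in one
    direction only, hence the separate cases $v\le1$ and $v>1$. *)
Lemma exists_dyadic_scale (R : realType) (v : R) : 0 < v ->
  exists2 N : int, 2 ^ N * v <= 1 & 1 < 2 * (2 ^ N * v).
Proof.
move=> v0.
have big (u : R) : exists k, u < 2 ^+ k.
  exists (Num.bound `|u|); apply: le_lt_trans (ler_norm u) _.
  apply: lt_trans (archi_boundP (normr_ge0 u)) _.
  by rewrite -natrX ltr_nat ltn_expl.
have [v1|v1] := leP v 1.
  have ex : exists k, 1 < 2 ^+ k * v.
    by have [k] := big v^-1; rewrite -div1r ltr_pdivrMr// => ?; exists k.
  case: (ex_minnP ex) => -[|k]; first by rewrite expr0 mul1r ltNge v1.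
  move=> lt min; exists k%:Z; last by rewrite -exprnP mulrA -exprS.
  by rewrite -exprnP leNgt; apply/negP => /min; rewrite ltnn.
have ex : exists k, (2 ^+ k)^-1 * v <= 1.
  by have [k] := big v => lt; exists k; rewrite ler_pdivrMl ?exprn_gt0// mulr1 ltW.
case: (ex_minnP ex) => -[|k]; first by rewrite expr0 invr1 mul1r leNgt v1.
move=> le min; exists (- k.+1%:Z); rewrite -exprnN//.
rewrite exprS invfM -mulrA mulrA mulfV ?mul1r//.
by rewrite ltNge; apply/negP => /min; rewrite ltnn.
Qed.

Section cubes.
Context {R : realType} {n : nat}.
Local Notation mu := (lebesgue_rV n).
Implicit Types (f g a : 'rV[R]_n -> R[i]) (c : 'rV[R]_n) (l M : R).

Lemma is_cube_ccube c l : 0 < l -> is_cube (ccube c l).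
Proof. by move=> l0; exists c, l. Qed.

Lemma vol_ccube c l : 0 <= l -> vol (ccube c l) = l ^+ n.
Proof. by move=> l0; rewrite /vol lebesgue_ccube. Qed.

Lemma bounded_in_leM c l M M' f : M <= M' -> bounded_in c l M f ->
  bounded_in c l M' f.
Proof.
move=> MM [mf fM f0]; split => //.
by apply: filterS fM => x /le_trans; exact.
Qed.

Lemma cintegral_indic (A : set 'rV[R]_n) (v : R) : measurable A ->
  mu A = v%:E -> cintegral mu setT (fun y => (\1_A y : R)%:C%C) = v%:C%C.
Proof.
move=> mA Av; apply/eqP; rewrite eq_complex /= /Rintegral.
rewrite integral_indic// setIT [X in fine X](_ : _ = v%:E); last exact: Av.
by rewrite integral0 !eqxx.
Qed.

(** Maximality of $N_E$ gives $2^{N_E}l^n>1/2$, so division by $k\ge6l^n$ brings the bound $3$ below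
    $2^{N_E}$. *)
Lemma A1_ccube c l (k : R) f : 0 < l -> 3 * (2 * l ^+ n) <= k ->
  bounded_in c l 3 f -> cintegral mu setT f = 0 ->
  A1 (fun z => (k^-1)%:C%C * f z).
Proof.
move=> l0 kl bf f0; exists (ccube c l); first exact: is_cube_ccube.
have ln : 0 < l ^+ n by rewrite exprn_gt0.
have k0 : 0 < k by apply: lt_le_trans kl; rewrite !mulr_gt0.
have [ma aM a0] := bounded_inM (k^-1)%:C%C bf.
split => //.
- exact: csupp_ccube.
- have [N N1 N2] := exists_dyadic_scale ln.
  exists N; first split; rewrite ?vol_ccube ?(ltW l0)//.
    move=> M M1; rewrite -ltzD1 -(@ltr_eXz2l R 2) ?ltr1n//.
    rewrite -(ltr_pM2r ln); apply: le_lt_trans M1 _.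
    by rewrite exprzDr ?unitfE// expr1z (mulrC _ 2) -mulrA.
  apply/Lp_norm_yP; apply: filterS aM => x /le_trans; apply.
  rewrite cabs_real ger0_norm ?invr_ge0 ?(ltW k0)// mulrC ler_pdivrMr//.
  apply: (@le_trans _ _ (2 ^ N * (3 * (2 * l ^+ n)))).
    by move: N2; set e := 2 ^ N; nra.
  by rewrite ler_wpM2l// exprz_ge0.
- rewrite cintegralMl// ?f0 ?mulr0//.
  by apply: (bounded_in_integrable (ltW l0) _ bf).
Qed.

Lemma ereal_sup_bound (S : set (\bar R)) : (ereal_sup S < +oo)%E ->
  exists2 C : R, 0 < C & forall x, S x -> (x <= C%:E)%E.
Proof.
move=> Soo; have h x : S x -> (x <= ereal_sup S)%E by exact: ereal_sup_ubound.
case: (ereal_sup S) Soo h => [r _ h|//|_ h].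
  exists (`|r| + 1); first by rewrite ltr_pwDr.
  move=> x /h /le_trans; apply; rewrite lee_fin.
  by rewrite (le_trans (ler_norm r))// lerDl.
by exists 1 => // x /h; rewrite leeNy_eq => /eqP ->; rewrite leNye.
Qed.

End cubes.

(** * Completing truncated functions to multiples of atoms *)

Section weak_type.
Context {R : realType} {n : nat}.
Local Notation mu := (lebesgue_rV n).
Implicit Types (f g a b : 'rV[R]_n -> R[i]) (x y c : 'rV[R]_n) (l M r W : R).
Variables (T : ('rV[R]_n -> R[i]) -> 'rV[R]_n -> R[i]).
Hypothesis n0 : (0 < n)%N.
Hypothesis mT : forall f, bounded_csupp f -> cmeasurable setT (T f).
Hypothesis linT : forall (a : R[i]) f g, bounded_csupp f -> bounded_csupp g ->
  {ae mu, forall x, T (fun z => a * f z + g z) x = a * T f x + T g x}.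

Local Notation D := (2 * n%:R : R)%R.

Lemma bounded_csupp0 : bounded_csupp (fun _ : 'rV[R]_n => 0 : R[i]).
Proof.
apply: (@bounded_in_csupp _ _ 0 1 0); split => //; first exact: cmeasurable_cst.
by apply/nearW => x; rewrite cabs0.
Qed.

(** Linearity is given as $T(af+g)=aTf+Tg$ almost everywhere: with $a=1$ and $f=g=0$ it yields
    $T0=0$, and then $g=0$ yields homogeneity. *)
Lemma T_scale (k : R[i]) f : bounded_csupp f ->
  {ae mu, forall x, T (fun z => k * f z) x = k * T f x}.
Proof.
move=> cf; have c0 := bounded_csupp0.
have := linT 1 c0 c0; rewrite (_ : (fun z => 1 * 0 + 0) = fun=> 0); last first.
  by apply/funext => z; rewrite mulr0 addr0.
have := linT k cf c0; rewrite (_ : (fun z => k * f z + 0) = fun z => k * f z); last first.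
  by apply/funext => z; rewrite addr0.
apply: filterS2 => x ->; rewrite mul1r => /eqP.
by rewrite -subr_eq subrr eq_sym => /eqP ->; rewrite addr0.
Qed.

Lemma WL1_scale (k W : R) a lam : 0 < k -> 0 < lam -> bounded_csupp a ->
  bounded_csupp (fun z => k%:C%C * a z) ->
  (WL1_norm (T a) <= W%:E)%E ->
  (mu [set x | (cabs (T (fun z => k%:C%C * a z)%R x) > lam)%R] <=
    (k * W / lam)%:E)%E.
Proof.
move=> k0 lam0 ca cka /ereal_supP h.
have lk : 0 < lam / k by rewrite divr_gt0.
have {h} := h _ (ex_intro2 _ _ (lam / k) lk erefl).
set B := [set x | _] => le.
have mB : measurable B by apply: measurable_cabs_gt; exact: mT.
apply: (@le_trans _ _ (mu B)).
  apply: measure_ae_le => //; first by apply: measurable_cabs_gt; exact: mT.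
  apply: filterS (T_scale k%:C%C ca) => x /= ->.
  rewrite cabsM cabs_real gtr0_norm// => lt.
  by rewrite /B /= ltr_pdivrMr// mulrC.
rewrite (_ : k * W / lam = (lam / k)^-1 * W); last first.
  by rewrite invf_div mulrAC.
by rewrite EFinM lee_pdivlMl.
Qed.

(** The correction is $-m\chi_S$, where [S] is a cube with the volume of [qstar c l] and [m] is the
    mean of [f] over the latter. The complex integral bound gives $|m|\le2$, so the corrected
    function is bounded by $3$, as [A1_ccube] requires. *)
Lemma localizable_bounded W f c' l' : 0 < W -> 0 <= l' -> bounded_in c' l' 1 f ->
  (forall a, A1 a -> (WL1_norm (T a) <= W%:E)%E) ->
  localizable T (6 * (10 * D) ^+ n * W) f.
Proof.
move=> W0 l'0 bf weak c l l0.
have D2 : 2 <= D by rewrite ler_peMr// ler1n.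
have Dl : 2 * l <= D * l by rewrite ler_wpM2r// ltW.
have Dl0 : 0 < D * l by lra.
have Q0 : 0 < 2 * (D * l) by lra.
have E0 : 0 < 10 * (D * l) by lra.
pose f1 := restr (qstar c l) f.
have bf1 : bounded_in (c - const_mx (D * l)) (2 * (D * l)) 1 f1.
  have [m1 m2 _] := bounded_in_restr (measurable_qstar c l) bf.
  by split => // y ny; exact: restr_notin.
have if1 := bounded_in_integrable (ltW Q0) ler01 bf1.
pose V := (2 * (D * l)) ^+ n.
have V0 : 0 < V by rewrite exprn_gt0.
pose m : R[i] := (V^-1)%:C%C * cintegral mu setT f1.
have m2 : cabs (- m) <= 2.
  rewrite cabsN cabsM cabs_real ger0_norm ?invr_ge0 ?(ltW V0)// mulrC ler_pdivrMr//.
  rewrite -lee_fin; apply: le_trans (cabs_cintegral_le _ _ _) _ => //; first by case: bf1.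
  rewrite EFinM lee_wpmul2l ?lee_fin//.
  by have := integral_cabs_le (ltW Q0) ler01 bf1; rewrite mul1r.
pose S := ccube (c + const_mx (2 * (D * l))) (2 * (D * l)).
have mS : measurable S by exact: measurable_ccube.
have SE : S `<=` ccube (c - const_mx (D * l)) (10 * (D * l)).
  move=> y yS i; have /andP[h1 h2] := yS i; rewrite !mxE in h1 h2 *.
  by apply/andP; split; lra.
have bS := bounded_in_indic mS SE.
pose b := fun y => - m * (\1_S y : R)%:C%C.
have bb : bounded_in (c - const_mx (D * l)) (10 * (D * l)) 2 b.
  by apply: bounded_in_leM (bounded_inM (- m) bS); rewrite mulr1.
exists b; split => //.
  move=> y; rewrite /b indicE => by0 i.
  have yS : S y.
    by apply: contrapT => nS; move: by0; rewrite memNset// mulr0 eqxx.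
  by have /andP[h1 _] := yS i; rewrite !mxE in h1; lra.
move=> lam lam0; pose p := fun z => 1 * restr (qstar c l) f z + b z; rewrite -/p.
have pE : p = (fun z => f1 z + b z) by apply/funext => z; rewrite /p mul1r.
have bp : bounded_in (c - const_mx (D * l)) (10 * (D * l)) 3 p.
  rewrite pE (_ : 3 = 1 + 2)//; apply: bounded_inD => //.
  apply: bounded_in_le bf1 => y h i; have /andP[h1 h2] := h i.
  by apply/andP; split => //; lra.
have p0 : cintegral mu setT p = 0.
  rewrite (@eq_cintegral _ _ _ _ _ _ (fun y => f1 y - m * (\1_S y : R)%:C%C)); last first.
    by move=> y _; rewrite pE /b mulNr.
  have iS := bounded_in_integrable (ltW E0) ler01 bS.
  rewrite cintegralB//; last first.
    apply: (bounded_in_integrable (ltW E0) _ (bounded_inM m bS)).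
    by rewrite mulr1 cabs_ge0.
  rewrite cintegralMl// (cintegral_indic (v := V))//; last first.
    by rewrite lebesgue_ccube// ltW.
  rewrite /m mulrAC -rmorphM /= mulVf ?gt_eqF// mul1r subrr//.
pose k := 3 * (2 * (10 * (D * l)) ^+ n).
have k0 : 0 < k by rewrite !mulr_gt0// exprn_gt0.
have aA := A1_ccube E0 (lexx k) bp p0.
have paE : p = (fun z => k%:C%C * ((k^-1)%:C%C * p z)).
  apply/funext => z; rewrite mulrA -rmorphM /= mulfV ?gt_eqF// mul1r//.
have cp := bounded_in_csupp bp.
have ca := bounded_in_csupp (bounded_inM (k^-1)%:C%C bp).
rewrite paE in cp.
have := WL1_scale k0 lam0 ca cp (weak _ aA); rewrite -paE.
move/le_trans; apply; rewrite lee_fin ler_pM2r ?invr_gt0//.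
rewrite le_eqVlt; apply/orP; left; apply/eqP.
by rewrite /k !exprMn; ring.
Qed.

(** An indicator cannot be corrected by an arbitrary multiple of another one, so measures are
    matched instead: [G] is a cube with the measure of [F']. Adjoining [S] to the truncated set
    makes this measure positive, so that [G] is a genuine cube even if the truncated set is null. *)
Lemma localizable_indic W (F : set 'rV[R]_n) : 0 < W -> measurable F ->
  (forall a, A10 a -> (WL1_norm (T a) <= W%:E)%E) ->
  localizable T ((10 * D) ^+ n * W) (fun y => (\1_F y : R)%:C%C).
Proof.
move=> W0 mF weak c l l0.
have D2 : 2 <= D by rewrite ler_peMr// ler1n.
have Dl : 2 * l <= D * l by rewrite ler_wpM2r// ltW.
have Dl0 : 0 < D * l by lra.
have Q0 : 0 < 2 * (D * l) by lra.
have E0 : 0 < 10 * (D * l) by lra.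
have H0 : 0 < 5 * (D * l) by lra.
set f := fun y => _.
(* In each coordinate, in units of $Dl$ from [c]: [qstar c l] is $[-1,1]$, [S] is $[2,4]$, [H] is
   $[-1,4]$, and [G] starts at $5$ with side at most $4$. All fit into $E=[-1,9]$, whence the factor
   $10$. *)
pose E := ccube (c - const_mx (D * l)) (10 * (D * l)).
pose H := ccube (c - const_mx (D * l)) (5 * (D * l)).
pose S := ccube (c + const_mx (2 * (D * l))) (2 * (D * l)).
pose V := (2 * (D * l)) ^+ n.
have V0 : 0 < V by rewrite exprn_gt0.
have mq := measurable_qstar c l.
have mS : measurable S by exact: measurable_ccube.
have muS : mu S = V%:E by rewrite lebesgue_ccube// ltW.
have muq : mu (qstar c l) = V%:E by rewrite lebesgue_ccube// ltW.
pose F' := (F `&` qstar c l) `|` S.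
have mFq : measurable (F `&` qstar c l) by exact: measurableI.
have mF' : measurable F' by exact: measurableU.
have F'_le : (mu F' <= (2 * V)%:E)%E.
  rewrite mulr_natl mulr2n EFinD -{1}muq -muS.
  apply: measure_le_setU2 => //.
  by move=> y [[_ yq]|yS]; [left|right].
have F'_ge : (V%:E <= mu F')%E.
  by rewrite -muS; apply: le_measure; rewrite ?inE//; exact: subsetUr.
have F'fin : mu F' \is a fin_num.
  by rewrite ge0_fin_numE//; apply: le_lt_trans F'_le _; rewrite ltry.
pose v := fine (mu F').
have vE : mu F' = v%:E by rewrite fineK.
have v0 : 0 < v by rewrite -lte_fin -vE; apply: lt_le_trans F'_ge; rewrite lte_fin.
pose s := v `^ (n%:R^-1).
have s0 : 0 < s by rewrite powR_gt0.
have sn : s ^+ n = v.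
  rewrite -powR_mulrn ?ltW// -powRrM mulVf ?pnatr_eq0 -?lt0n//.
  by rewrite powRr1// ltW.
(* $|F'|\le2(2Dl)^n\le(4Dl)^n$, as $n\ge1$. *)
have s4 : s <= 4 * (D * l).
  rewrite -(@ler_pXn2r _ n) ?nnegrE ?(ltW s0)//; last lra.
  rewrite sn -lee_fin -vE; apply: le_trans F'_le _; rewrite lee_fin /V.
  rewrite (_ : 4 * (D * l) = 2 * (2 * (D * l))); last by ring.
  rewrite (exprMn _ 2 (2 * (D * l))) ler_pM2r//.
  by rewrite -[leLHS]expr1 ler_weXn2l// ler1n.
pose G := ccube (c + const_mx (5 * (D * l))) s.
have mG : measurable G by exact: measurable_ccube.
have muG : mu G = v%:E by rewrite -sn lebesgue_ccube// ltW.
have GE : G `<=` E.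
  move=> y yG i; have /andP[h1 h2] := yG i; rewrite !mxE in h1 h2 *.
  by apply/andP; split; lra.
have HE : H `<=` E.
  by move=> y yH i; have /andP[h1 h2] := yH i; apply/andP; split => //; lra.
have SH : S `<=` H.
  move=> y yS i; have /andP[h1 h2] := yS i; rewrite !mxE in h1 h2 *.
  by apply/andP; split; lra.
have qH : qstar c l `<=` H.
  by move=> y yH i; have /andP[h1 h2] := yH i; apply/andP; split => //; lra.
have F'H : F' `<=` H by move=> y [[_ /qH]|/SH].
have GH : G `&` H = set0.
  apply/seteqP; split => // y [/(_ (Ordinal n0)) + /(_ (Ordinal n0))].
  by rewrite !mxE => /andP[h1 h2] /andP[h3 h4]; exfalso; lra.
have qS y : qstar c l y -> S y -> False.
  move=> /(_ (Ordinal n0)) + /(_ (Ordinal n0)).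
  by rewrite !mxE => /andP[h1 h2] /andP[h3 h4]; lra.
pose b := fun y => (-1) * (\1_G y : R)%:C%C + (\1_S y : R)%:C%C.
have bb : bounded_in (c - const_mx (D * l)) (10 * (D * l)) 2 b.
  have SE : S `<=` E by move=> y /SH/HE.
  apply: bounded_in_leM
    (bounded_inD (bounded_inM (-1) (bounded_in_indic mG GE)) (bounded_in_indic mS SE)).
  by rewrite cabsN (_ : 1 = 1%:C%C :> R[i])// cabs_real normr1 mulr1.
exists b; split => //.
  move=> y by0 i; have [yG|nG] := pselect (G y).
    by have /andP[h1 _] := yG i; rewrite !mxE in h1; lra.
  have [yS|nS] := pselect (S y).
    by have /andP[h1 _] := yS i; rewrite !mxE in h1; lra.
  by move: by0; rewrite /b !indicE !memNset// mulr0 addr0 eqxx.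
move=> lam lam0; pose p := fun z => 1 * restr (qstar c l) f z + b z; rewrite -/p.
pose k := (10 * (D * l)) ^+ n.
have k0 : 0 < k by rewrite exprn_gt0.
pose a := fun x => ((vol E)^-1 * (\1_F' x - \1_G x) : R)%:C%C.
have volE : vol E = k by rewrite vol_ccube// ltW.
have aA : A10 a.
  exists E; first exact: is_cube_ccube.
  exists G, H, F'; split => //.
  - by split => //; exact: is_cube_ccube.
  - by split => //; exact: is_cube_ccube.
  - by split => //; rewrite vE muG.
have paE : p = (fun z => k%:C%C * a z).
  apply/funext => z; rewrite /a volE rmorphM /= mulrA -rmorphM /= mulfV ?gt_eqF//.
  rewrite mul1r /p mul1r /b rmorphB /= addrA addrAC mulN1r; congr (_ - _).
  rewrite /restr /f -rmorphM -rmorphD /=; congr (_%:C)%C.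
  rewrite !indicE /F' in_setU in_setI.
  case: (boolP (z \in S)) => [/set_mem zS|_]; last first.
    by rewrite orbF addr0; case: (z \in F); case: (z \in _); rewrite /= ?mulr1 ?mulr0 ?mul0r.
  rewrite orbT (_ : z \in qstar c l = false) ?mul0r ?add0r//.
  by apply: memNset => zq; exact: qS zq zS.
have bfq : bounded_in (c - const_mx (D * l)) (10 * (D * l)) 1 (restr (qstar c l) f).
  have -> : restr (qstar c l) f = fun y => (\1_(F `&` qstar c l) y : R)%:C%C.
    apply/funext => y; rewrite /restr /f -rmorphM /= !indicE in_setI.
    by case: (y \in F); case: (y \in _); rewrite /= ?mulr1 ?mulr0 ?mul0r.
  by apply: bounded_in_indic => // y [_ /qH/HE].
have bp : bounded_in (c - const_mx (D * l)) (10 * (D * l)) (1 + 2) p.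
  rewrite (_ : p = fun z => restr (qstar c l) f z + b z); first exact: bounded_inD.
  by apply/funext => z; rewrite /p mul1r.
have cp := bounded_in_csupp bp.
have ca : bounded_csupp a.
  have := bounded_in_csupp (bounded_inM (k^-1)%:C%C bp).
  rewrite paE (_ : (fun y => _) = a)//.
  by apply/funext => z; rewrite mulrA -rmorphM /= mulVf ?gt_eqF// mul1r.
rewrite paE in cp *.
apply: le_trans (WL1_scale k0 lam0 ca cp (weak _ aA)) _.
rewrite lee_fin ler_pM2r ?invr_gt0// le_eqVlt; apply/orP; left; apply/eqP.
by rewrite /k !exprMn; ring.
Qed.

End weak_type.

(** * Setting the kernel to zero on the diagonal *)

Section off_diagonal_kernel.
Context {R : realType} {n : nat}.
Local Notation mu := (lebesgue_rV n).
Implicit Types (f g a b : 'rV[R]_n -> R[i]) (x y c : 'rV[R]_n) (l M r W : R).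

(* [has_kernel] says nothing on the diagonal; with value [0] there, the kernel
   is measurable on the whole of [R^n * R^n]. *)
Definition off_diag (K : 'rV[R]_n -> 'rV[R]_n -> R[i]) x y : R[i] :=
  if x == y then 0 else K x y.

Lemma off_diagE K x y : x != y -> off_diag K x y = K x y.
Proof. by rewrite /off_diag; case: eqP. Qed.

Lemma cmeasurable_off_diag K :
  cmeasurable off_diagonal (fun p => K p.1 p.2) ->
  cmeasurable setT (fun p => off_diag K p.1 p.2).
Proof.
move=> [m1 m2].
have md : measurable_fun setT (fun p : 'rV[R]_n * 'rV[R]_n => p.1 == p.2).
  apply: (measurable_fun_bool true); rewrite setTI.
  rewrite (_ : _ @^-1` _ = [set p | p.1 = p.2]); first exact: measurable_diagonal.
  by apply/seteqP; split => p /= /eqP.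
have off : [set: 'rV[R]_n * 'rV[R]_n] `&` (fun p => p.1 == p.2) @^-1` [set false]
    = off_diagonal.
  by apply/seteqP; split => [p [_] /= /negbT//|p /= /negPf pn]; split.
split.
- rewrite (_ : _ \o _ = fun p => if p.1 == p.2 then 0 else complex.Re (K p.1 p.2)).
    by apply: measurable_fun_if => //; rewrite off.
  by apply/funext => p; rewrite /off_diag /=; case: ifP.
- rewrite (_ : _ \o _ = fun p => if p.1 == p.2 then 0 else complex.Im (K p.1 p.2)).
    by apply: measurable_fun_if => //; rewrite off.
  by apply/funext => p; rewrite /off_diag /=; case: ifP.
Qed.

Lemma enorm_gt0_neq x y : 0 < enorm (x - y) -> x != y.
Proof.
apply: contraTneq => ->; rewrite subrr -leNgt /enorm big1 ?sqrtr0//.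
by move=> i _; rewrite mxE expr0n.
Qed.

Lemma size_off_diag (T : operator R n) : has_kernel T -> size_condition T ->
  exists2 CS, 0 < CS & forall x r, 0 < r ->
  (\int[mu]_(y in [set y | (r <= enorm (x - y) <= 2 * r)%R])
     (cabs (off_diag (kern T) x y))%:E <= CS%:E)%E.
Proof.
move=> [mk _ _] /ereal_sup_bound[CS CS0 h]; exists CS => // x r r0.
have mK := cmeasurable_off_diag mk.
apply: le_trans (h _ (ex_intro2 _ _ (x, r) r0 erefl)) => /=.
have mA : measurable [set y : 'rV[R]_n | r <= enorm (x - y) <= 2 * r].
  exact: measurable_annulus.
rewrite [leRHS](eq_integral (fun y => (cabs (off_diag (kern T) x y) +
    cabs (off_diag (kern T) y x))%:E)); last first.
  move=> y /set_mem /= /andP[ry _].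
  have xy : x != y by apply: enorm_gt0_neq; exact: lt_le_trans ry.
  by rewrite !off_diagE// eq_sym.
have m1 := measurable_cabs (cmeasurable_kernel_l mK x).
have m2 := measurable_cabs (cmeasurable_kernel_r mK x).
apply: ge0_le_integral => //.
- by move=> y _; rewrite lee_fin cabs_ge0.
- by apply/measurable_EFinP; exact: measurable_funTS.
- by apply/measurable_EFinP; apply: measurable_funTS; exact: measurable_funD.
- by move=> y _; rewrite lee_fin lerDl cabs_ge0.
Qed.

(** For $x\ne x'$ the domain contains neither point: $y=x$ would give $0\ge2|x-x'|$, and $y=x'$
    would give $|x-x'|\ge2|x-x'|$. For $x=x'$ the domain is the whole space, but the integrand
    vanishes. *)
Lemma hormander_off_diag (T : operator R n) :
  has_kernel T -> hormander_condition T ->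
  exists2 CH, 0 < CH & forall x x',
  (\int[mu]_(y in [set y | (2 * enorm (x - x') <= enorm (x - y))%R])
     (cabs (off_diag (kern T) x y - off_diag (kern T) x' y) +
      cabs (off_diag (kern T) y x - off_diag (kern T) y x'))%:E <= CH%:E)%E.
Proof.
move=> [mk _ _] /ereal_sup_bound[CH CH0 h]; exists CH => // x x'.
have [->|xx'] := eqVneq x x'.
  rewrite integral0_eq ?lee_fin ?ltW// => y _.
  by rewrite !subrr cabs0 addr0.
apply: le_trans (h _ (ex_intro2 _ _ (x, x') I erefl)) => /=.
rewrite le_eqVlt; apply/orP; left; apply/eqP.
apply: eq_integral => y /set_mem /= le.
have d0 : 0 < enorm (x - x').
  rewrite lt_neqAle enorm_ge0 andbT eq_sym; apply: contraNneq xx' => d0.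
  apply/eqP/rowP => i; apply/eqP; rewrite -subr_eq0 -normr_le0.
  by have := normr_coord_le_enorm (x - x') i; rewrite d0 !mxE.
have xy : x != y by apply: enorm_gt0_neq; lra.
have x'y : x' != y.
  apply: contraTneq le => <-; rewrite -ltNge; lra.
by rewrite !off_diagE// eq_sym.
Qed.

(** The integrands can differ only at $y=x$, where [f] kills both; this covers every point outside
    the support of [f]. *)
Lemma eq_cintegral_off_diag (T : operator R n) f x : f x = 0 ->
  cintegral mu setT (fun y => kern T x y * f y) =
  cintegral mu setT (fun y => off_diag (kern T) x y * f y).
Proof.
move=> fx; apply: eq_cintegral => y _; rewrite /off_diag.
by case: eqP => // <-; rewrite fx !mulr0.
Qed.

End off_diagonal_kernel.

(** * The two implications for an operator in [HCZ] *)

Section bounds.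
Context {R : realType} {n : nat}.
Local Notation mu := (lebesgue_rV n).
Implicit Types (f g a b : 'rV[R]_n -> R[i]) (x y c : 'rV[R]_n) (l M r W : R).
Variable T : operator R n.
Hypothesis n0 : (0 < n)%N.
Hypothesis T_HCZ : HCZ T.
Hypothesis T_acts : acts_on_bounded T.

Local Notation D := (2 * n%:R : R)%R.

Let mT f : bounded_csupp f -> cmeasurable setT (act T f).
Proof. by case: T_acts => -[h _ _ _] _ _; exact: h. Qed.

Let linT (a : R[i]) f g : bounded_csupp f -> bounded_csupp g ->
  {ae mu, forall x, act T (fun z => a * f z + g z) x = a * act T f x + act T g x}.
Proof. by case: T_acts => -[_ h _ _] _ _; exact: h. Qed.

Let kerT f : bounded_csupp f -> {ae mu, forall x, ~ csupp f x ->
  act T f x = cintegral mu setT (fun y => off_diag (kern T) x y * f y)}.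
Proof.
case: T_acts => -[_ _ _ h] _ _ /h; apply: filterS => x + nx => /(_ nx) ->.
apply: eq_cintegral_off_diag; apply: contrapT => /eqP fx; apply: nx.
exact: subset_closure.
Qed.

Let mK : cmeasurable setT (fun p => off_diag (kern T) p.1 p.2).
Proof. by case: T_HCZ => -[_ hk] _ _ _ _; apply: cmeasurable_off_diag; case: hk. Qed.

Lemma act_near W : 0 < W -> exists C, forall f c l, 0 < l ->
  bounded_in c l 1 f -> localizable (act T) W f ->
  (\int[mu]_(x in hcube (c - const_mx (D * l)%R) (2 * (D * l))%R)
    (cabs (act T f x))%:E <= (C * l ^+ n)%:E)%E.
Proof.
case: T_HCZ => -[_ hk] /(size_off_diag hk)[CS CS0 sizeK].
move=> /(hormander_off_diag hk)[CH CH0 horm] _ _ W0.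
exists (6 * (W * 2 ^+ n.+2 + osc_const (n := n) CS CH) * (2 * D) ^+ n).
move=> f c l l0 bf loc.
have E A : A * (2 * D) ^+ n * l ^+ n = A * (2 * (D * l)) ^+ n.
  by rewrite -[LHS]mulrA -exprMn -(mulrA 2 D l).
rewrite E.
apply: (@T_near _ _ (off_diag (kern T))) => //; try exact: ltW.
move=> x x'; apply: le_trans (horm x x'); apply: ge0_le_integral => //.
- exact: measurable_outside.
- by move=> y _; rewrite lee_fin cabs_ge0.
- apply: measurable_ecabs; apply: cmeasurableW.
  by apply: cmeasurableB; exact: cmeasurable_kernel_l mK _.
- apply/measurable_EFinP; apply: measurable_funD; apply: measurable_cabs;
    apply: cmeasurableW; apply: cmeasurableB.
  + exact: cmeasurable_kernel_l mK _.
  + exact: cmeasurable_kernel_l mK _.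
  + exact: cmeasurable_kernel_r mK _.
  + exact: cmeasurable_kernel_r mK _.
- by move=> y _; rewrite lee_fin lerDl cabs_ge0.
Qed.

Lemma act_far : exists C, forall f c l, 0 < l ->
  bounded_in c l 1 f -> cintegral mu setT f = 0 ->
  (\int[mu]_(x in ~` hcube (c - const_mx (D * l)%R) (2 * (D * l))%R)
    (cabs (act T f x))%:E <= (C * l ^+ n)%:E)%E.
Proof.
case: T_HCZ => -[_ hk] /(size_off_diag hk)[CS CS0 sizeK].
move=> /(hormander_off_diag hk)[CH CH0 horm] _ _.
exists (2 * CH) => f c l l0 bf f0.
apply: (@T_far _ _ (off_diag (kern T)) CS) => //; try exact: ltW.
move=> x x'; apply: le_trans (horm x x'); apply: ge0_le_integral => //.
- exact: measurable_outside.
- by move=> y _; rewrite lee_fin cabs_ge0.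
- apply: measurable_ecabs; apply: cmeasurableW.
  by apply: cmeasurableB; exact: cmeasurable_kernel_r mK _.
- apply/measurable_EFinP; apply: measurable_funD; apply: measurable_cabs;
    apply: cmeasurableW; apply: cmeasurableB.
  + exact: cmeasurable_kernel_l mK _.
  + exact: cmeasurable_kernel_l mK _.
  + exact: cmeasurable_kernel_r mK _.
  + exact: cmeasurable_kernel_r mK _.
- by move=> y _; rewrite lee_fin lerDr cabs_ge0.
Qed.

Lemma Lp_norm1E f : Lp_norm 1 f = (\int[mu]_x (cabs (f x))%:E)%E.
Proof.
rewrite /Lp_norm Lnorm1; apply: eq_integral => x _.
by rewrite gee0_abs// lee_fin cabs_ge0.
Qed.

Lemma Lp_norm1_act_le (C1 C2 : R) f c l : 0 < l -> bounded_in c l 1 f ->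
  (\int[mu]_(x in hcube (c - const_mx (D * l)%R) (2 * (D * l))%R)
    (cabs (act T f x))%:E <= (C1 * l ^+ n)%:E)%E ->
  (\int[mu]_(x in ~` hcube (c - const_mx (D * l)%R) (2 * (D * l))%R)
    (cabs (act T f x))%:E <= (C2 * l ^+ n)%:E)%E ->
  (Lp_norm 1 (act T (fun z => ((l ^+ n)^-1)%:C%C * f z)%R) <= (C1 + C2)%:E)%E.
Proof.
move=> l0 bf le1 le2; set Q := hcube _ _ in le1 le2.
have mQ : measurable Q by exact: measurable_hcube.
have ln : 0 < l ^+ n by rewrite exprn_gt0.
have cf := bounded_in_csupp bf.
have cg := bounded_in_csupp (bounded_inM ((l ^+ n)^-1)%:C%C bf).
have mTf := measurable_ecabs (mT cf).
rewrite Lp_norm1E.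
apply: (@le_trans _ _ (\int[mu]_x (((l ^+ n)^-1)%:E * (cabs (act T f x))%:E))%E).
  apply: ae_ge0_le_integral => //.
  - by move=> x _; rewrite lee_fin cabs_ge0.
  - by apply: measurable_ecabs; exact: mT.
  - by move=> x _; rewrite mule_ge0// lee_fin ?cabs_ge0// invr_ge0 ltW.
  - exact: measurable_funeM.
  - apply: filterS (T_scale linT ((l ^+ n)^-1)%:C%C cf) => x -> _.
    by rewrite cabsM cabs_real ger0_norm ?invr_ge0 ?(ltW ln).
rewrite ge0_integralZl//; last 2 first.
- by move=> x _; rewrite lee_fin cabs_ge0.
- by rewrite lee_fin invr_ge0 ltW.
rewrite lee_pdivrMl// -(setUv Q) ge0_integral_setU//; last 4 first.
- exact: measurableC.
- by rewrite setUv.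
- by move=> x _; rewrite lee_fin cabs_ge0.
- by apply/disj_setPS => x [].
by rewrite -EFinM mulrC mulrDl EFinD leeD.
Qed.

Lemma act_A1 : (ereal_sup [set WL1_norm (act T a) | a in A1] < +oo)%E ->
  (ereal_sup [set Lp_norm 1 (act T a) | a in A1] < +oo)%E.
Proof.
move=> /ereal_sup_bound[W W0 weak].
have D0 : 0 < D by rewrite mulr_gt0// ltr0n.
have W'0 : 0 < 6 * (10 * D) ^+ n * W by rewrite !mulr_gt0// exprn_gt0// mulr_gt0.
have [C1 near] := act_near W'0; have [C2 far] := act_far.
apply: (@le_lt_trans _ _ (C1 + C2)%:E); last exact: ltry.
apply: ge_ereal_sup => _ [a [E [c [l [l0 ->]]] [ma sa [N [N1 _] aN] a0]] <-].
rewrite -/(ccube c l) in sa N1.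
have ln : 0 < l ^+ n by rewrite exprn_gt0.
rewrite vol_ccube ?(ltW l0)// in N1.
have supp x : ~ ccube c l x -> a x = 0.
  move=> nx; apply: contrapT => /eqP ax; apply/nx/sa; exact: subset_closure.
(* The scale satisfies $2^Nl^n\le1$, so the rescaled atom is bounded by $1$ whatever its cube. *)
pose f := fun z => (l ^+ n)%:C%C * a z.
have ba : bounded_in c l (2 ^ N) a by split => //; exact/Lp_norm_yP.
have bf : bounded_in c l 1 f.
  apply: bounded_in_leM (bounded_inM (l ^+ n)%:C%C ba).
  by rewrite cabs_real ger0_norm ?(ltW ln)// mulrC.
have f0 : cintegral mu setT f = 0.
  rewrite cintegralMl// ?a0 ?mulr0//.
  by apply: (bounded_in_integrable (ltW l0) _ ba); rewrite exprz_ge0.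
have -> : a = fun z => ((l ^+ n)^-1)%:C%C * f z.
  by apply/funext => z; rewrite mulrA -rmorphM /= mulVf ?gt_eqF// mul1r.
apply: (Lp_norm1_act_le l0 bf); last exact: far.
apply: near => //; apply: (localizable_bounded n0 mT linT W0 (ltW l0) bf).
by move=> b bA; apply: weak; exists b.
Qed.

Lemma act_A10 : (ereal_sup [set WL1_norm (act T a) | a in A10] < +oo)%E ->
  (ereal_sup [set Lp_norm 1 (act T a) | a in A10] < +oo)%E.
Proof.
move=> /ereal_sup_bound[W W0 weak].
have D0 : 0 < D by rewrite mulr_gt0// ltr0n.
have W'0 : 0 < (10 * D) ^+ n * W by rewrite !mulr_gt0// exprn_gt0// mulr_gt0.
have [C1 near] := act_near W'0; have [C2 far] := act_far.
apply: (@le_lt_trans _ _ (2 * C1 + C2)%:E); last exact: ltry.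
apply: ge_ereal_sup => _ [a [E [c [l [l0 ->]]] [G [H [F GHF]]]] <-].
move: GHF; rewrite -/(ccube c l) => -[[cG GE] [cH HE] GH [mF FH FG] ->].
rewrite vol_ccube ?(ltW l0)//.
have ln : 0 < l ^+ n by rewrite exprn_gt0.
have mG : measurable G by case: cG => c1 [l1 [_ ->]]; exact: (measurable_ccube c1 l1).
have FE : F `<=` ccube c l by move=> x /FH/HE.
pose f := fun z => (-1) * (\1_G z : R)%:C%C + (\1_F z : R)%:C%C.
have bG := bounded_in_indic mG GE; have bF := bounded_in_indic mF FE.
have cG' := bounded_in_csupp bG; have cF := bounded_in_csupp bF.
have locI A : measurable A ->
    localizable (act T) ((10 * D) ^+ n * W) (fun y => (\1_A y : R)%:C%C).
  move=> mA; apply: localizable_indic => // b bA; by apply: weak; exists b.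
have [m1 _ s1] := bounded_inD (bounded_inM (-1) bG) bF.
(* [F] and [G] are disjoint because [F] lies in [H]; the general rule for sums would only give the
   bound $2$. *)
have bf : bounded_in c l 1 f.
  split => //; apply/nearW => x; rewrite /f.
  rewrite -(rmorphN1 (@complex.real_complex R)) -rmorphM -rmorphD cabs_real mulN1r.
  rewrite !indicE.
  case: (boolP (x \in G)) => [/set_mem xG|_]; last first.
    by rewrite oppr0 add0r; case: (_ \in _); rewrite ?normr1 ?normr0.
  rewrite memNset ?addr0 ?normrN ?normr1// => /FH xH.
  by have : (G `&` H) x by []; rewrite GH.
have f0 : cintegral mu setT f = 0.
  have iG := bounded_in_integrable (ltW l0) ler01 bG.
  have iF := bounded_in_integrable (ltW l0) ler01 bF.
  rewrite (@eq_cintegral _ _ _ _ _ _ (fun y => (\1_F y : R)%:C%C - (\1_G y : R)%:C%C)).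
    have Gfin : mu G \is a fin_num.
      rewrite ge0_fin_numE//; apply: (@le_lt_trans _ _ (mu (ccube c l))).
        by apply: le_measure; rewrite ?inE//; exact: measurable_ccube.
      by rewrite lebesgue_ccube ?ltry// ltW.
    have muG : mu G = (fine (mu G))%:E by rewrite fineK.
    have muF : mu F = (fine (mu G))%:E by rewrite FG.
    by rewrite cintegralB// (cintegral_indic mG muG) (cintegral_indic mF muF) subrr.
  by move=> y _; rewrite /f mulN1r addrC.
rewrite (_ : (fun x => _) = fun z => ((l ^+ n)^-1)%:C%C * f z); last first.
  apply/funext => z; rewrite rmorphM /= rmorphB /= /f mulN1r.
  by rewrite (addrC (- _)).
apply: (Lp_norm1_act_le l0 bf); last exact: far.
set Q := hcube _ _.
have mQ : measurable Q by exact: measurable_hcube.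
(* [localizable_indic] concerns indicators, so the near part is estimated for [G] and [F]
   separately, whence the factor $2$ on [C1]. *)
apply: (@le_trans _ _ (\int[mu]_(x in Q)
    ((cabs (act T (fun y => (\1_G y : R)%:C%C) x))%:E +
     (cabs (act T (fun y => (\1_F y : R)%:C%C) x))%:E))%E).
  apply: ae_ge0_le_integral => //.
  - by move=> x _; rewrite lee_fin cabs_ge0.
  - by apply: measurable_ecabs; apply: cmeasurableW; apply: mT; exact: bounded_in_csupp bf.
  - by move=> x _; rewrite adde_ge0// lee_fin cabs_ge0.
  - by apply: emeasurable_funD; apply: measurable_ecabs; apply: cmeasurableW; exact: mT.
  - apply: filterS (linT (-1) cG' cF) => x -> _.
    rewrite -EFinD lee_fin mulN1r; apply: le_trans (ler_cabsD _ _) _.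
    by rewrite cabsN.
rewrite ge0_integralD//; last 4 first.
- by move=> x _; rewrite lee_fin cabs_ge0.
- by apply: measurable_ecabs; apply: cmeasurableW; exact: mT.
- by move=> x _; rewrite lee_fin cabs_ge0.
- by apply: measurable_ecabs; apply: cmeasurableW; exact: mT.
rewrite -mulrA mulr_natl mulr2n EFinD.
by apply: leeD; apply: near => //; exact: locI.
Qed.

End bounds.

Local Close Scope ring_scope.
Local Open Scope ereal_scope.

Theorem theorem1p3 (R : realType) (n : nat) (n_gt0 : (0 < n)%N)
    (T : operator R n) (T_HCZ : HCZ T) (T_acts : acts_on_bounded T) :
  (ereal_sup [set WL1_norm (act T a) | a in A1] < +oo ->
   ereal_sup [set Lp_norm 1 (act T a) | a in A1] < +oo) /\
  (ereal_sup [set WL1_norm (act T a) | a in A10] < +oo ->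
   ereal_sup [set Lp_norm 1 (act T a) | a in A10] < +oo).
Proof. by split; [exact: act_A1|exact: act_A10]. Qed.
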